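(* Let $C$ be an orientation of a cycle of even length $\ell$. If $\gamma_C=1$ and there exists an antisymmetric kernel $U:[0,1]^2\to[-1/2,1/2]$ such that \[\sum_{\substack{k\ge1,\ 1\le n_1\le\cdots\le n_k\\ k+2n_1+\cdots+2n_k\le\ell}}\frac{\alpha_C(2n_1,\ldots,2n_k)}{2^{\ell-2n_1-\cdots-2n_k}}\prod_{i=1}^k t(Q_{2n_i},U)+\gamma_C\cdot t(D_\ell,U)<0,\] then $C$ is not quasirandom-forcing. Similarly, if $\gamma_C=-1$ and there exists an antisymmetric kernel $U:[0,1]^2\to[-1/2,1/2]$ for which the same expression is $>0$, then $C$ is not quasirandom-forcing.
   Context: A kernel is a bounded measurable function $[0,1]^2\to\mathbb{R}$; it is antisymmetric if $U(x,y)=-U(y,x)$ for all $(x,y)$. A tournamenton is a non-negative kernel $W$ with $W(x,y)+W(y,x)=1$ for all $(x,y)$. For an oriented graph $H$ and a kernel $U$, $t(H,U)=\int_{[0,1]^{V(H)}}\prod_{vw\in E(H)}U(x_v,x_w)\,\mathrm{d}x_{V(H)}$; $\|H\|$ is the number of edges of $H$. $H$ is quasirandom-forcing if every tournamenton $W$ with $t(H,W)=2^{-\|H\|}$ equals $1/2$ almost everywhere. For a positive integer $n$, $Q_{2n}$ is the orientation of the path with $2n$ edges in which all edges are oriented away from the central vertex towards the two end vertices. For $n\ge 2$, $D_{2n}$ is the orientation of the cycle with $2n$ vertices obtained by choosing two opposite vertices and orienting all edges in the direction from one of them to the other. For an oriented cycle $C$ and $F\subseteq E(C)$, $C\langle F\rangle$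 is the spanning subgraph with edge set $F$. For positive integers $n_1,\ldots,n_k$, $\alpha_C(2n_1,\ldots,2n_k)$ is the number of sets $F\subseteq E(C)$ such that $C\langle F\rangle$ can be obtained from the vertex-disjoint union $Q_{2n_1}\cup\cdots\cup Q_{2n_k}$ by reversing an even number of edges and possibly adding isolated vertices, minus the number of sets $F$ such that $C\langle F\rangle$ can be obtained from it by reversing an odd number of edges and possibly adding isolated vertices. For an oriented cycle $C$ of even length $\ell$, $\gamma_C=+1$ if $C$ can be obtained from $D_\ell$ by reversing an even number of edges, and $\gamma_C=-1$ otherwise. *)

(* Defs.v *)
From HB Require Import structures.
From mathcomp Require Import all_boot all_order all_algebra.
From mathcomp Require Import all_classical all_reals all_analysis.
From mathcomp Require Import zify.

Set Implicit Arguments.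
Unset Strict Implicit.
Unset Printing Implicit Defensive.

Import Order.TTheory GRing.Theory Num.Theory.
Import numFieldNormedType.Exports.

Local Open Scope classical_set_scope.
Local Open Scope ring_scope.

Record ograph := OGraph {
  vert :> finType;
  edges : {set vert * vert};
  edges_oriented : forall u v, (u, v) \in edges -> (v, u) \notin edges }.

Definition ograph_iso (G H : ograph) : Prop :=
  exists2 f : G -> H, bijective f &
    forall u v, ((f u, f v) \in edges H) = ((u, v) \in edges G).

Section operations.
Context (G : ograph).

Definition spanning_edges (F : {set G * G}) : {set G * G} := edges G :&: F.

Fact spanning_oriented F u v :
  (u, v) \in spanning_edges F -> (v, u) \notin spanning_edges F.
Proof.
by rewrite !inE => /andP[uv _]; rewrite (negbTE (edges_oriented uv)).
Qed.

Definition spanning (F : {set G * G}) : ograph :=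
  OGraph (@spanning_oriented F).

Definition reverse_edges (S : {set G * G}) : {set G * G} :=
  [set e in edges G | e \notin S]
  :|: [set e | ((e.2, e.1) \in edges G) && ((e.2, e.1) \in S)].

Fact reverse_oriented S u v :
  (u, v) \in reverse_edges S -> (v, u) \notin reverse_edges S.
Proof.
rewrite !inE /= => /orP[|] /andP[uvE uvS];
  by rewrite (negbTE (edges_oriented uvE)) ?uvS ?(negbTE uvS) ?andbF.
Qed.

Definition reverse (S : {set G * G}) : ograph := OGraph (@reverse_oriented S).

End operations.

Section union.
Context (G H : ograph).

Definition dunion_edges : {set (G + H) * (G + H)} :=
  [set e | match e with
           | (inl u, inl v) => (u, v) \in edges G
           | (inr u, inr v) => (u, v) \in edges H
           | _ => false
           end].

Fact dunion_oriented u v :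
  (u, v) \in dunion_edges -> (v, u) \notin dunion_edges.
Proof.
by case: u v => [u|u] [v|v]; rewrite !inE //; exact: edges_oriented.
Qed.

Definition dunion : ograph := OGraph dunion_oriented.

End union.

Fact edgeless_oriented m (u v : 'I_m) :
  (u, v) \in (finset.set0 : {set 'I_m * 'I_m}) ->
  (v, u) \notin (finset.set0 : {set 'I_m * 'I_m}).
Proof. by rewrite finset.in_set0. Qed.

Definition edgeless (m : nat) : ograph := OGraph (@edgeless_oriented m).

(* [b] is the parity of the number of reversed edges (true = odd). *)
Definition obtained_by_reversing (b : bool) (G H : ograph) : Prop :=
  exists S : {set G * G},
    [/\ S \subset edges G, odd #|S| = b & ograph_iso (reverse S) H].

Definition obtained_by_reversing_and_isolated (b : bool) (G H : ograph) :
  Prop := exists m, obtained_by_reversing b (dunion G (edgeless m)) H.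

Section path_and_cycle.
Context (n : nat).

Definition Qpath_edges : {set 'I_n.*2.+1 * 'I_n.*2.+1} :=
  [set e : 'I_n.*2.+1 * 'I_n.*2.+1 |
    ((n <= e.1)%N && (e.2 == e.1.+1 :> nat)) ||
    ((e.1 <= n)%N && (e.1 == e.2.+1 :> nat))].

Fact Qpath_oriented u v :
  (u, v) \in Qpath_edges -> (v, u) \notin Qpath_edges.
Proof. rewrite !inE /=; lia. Qed.

(* [Qpath n] is Q_{2n}: the path 0, 1, ..., 2n, with central vertex n. *)
Definition Qpath : ograph := OGraph Qpath_oriented.

Definition Dcycle_edges : {set 'I_n.*2 * 'I_n.*2} :=
  [set e : 'I_n.*2 * 'I_n.*2 |
    [|| (e.1 < n)%N && (e.2 == e.1.+1 :> nat),
        (e.1 == 0%N :> nat) && (e.2.+1 == n.*2 :> nat) |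
        (n <= e.2)%N && (e.1 == e.2.+1 :> nat)]].

Fact Dcycle_oriented u v :
  (u, v) \in Dcycle_edges -> (v, u) \notin Dcycle_edges.
Proof. case: u v => [u ?] [v ?]; rewrite !inE /=; lia. Qed.

(* [Dcycle n] is D_{2n}, oriented from 0 to n along the two sides
   0, 1, ..., n and 0, 2n - 1, ..., n of the cycle. *)
Definition Dcycle : ograph := OGraph Dcycle_oriented.

End path_and_cycle.

Definition cycle_orientation (l : nat) (C : ograph) : Prop :=
  (3 <= l)%N /\
  exists2 f : 'I_l -> C, bijective f &
    forall i j : 'I_l,
      (((f i, f j) \in edges C) || ((f j, f i) \in edges C)) =
      (j == i.+1 %% l :> nat)%N || (i == j.+1 %% l :> nat)%N.

Definition Qunion (ns : seq nat) : ograph :=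
  foldr (fun n G => dunion (Qpath n) G) (edgeless 0) ns.

(* [alphaC C [:: n_1; ...; n_k]] is alpha_C(2n_1, ..., 2n_k). *)
Definition alphaC (C : ograph) (ns : seq nat) : int :=
  let N b := #|[set F : {set C * C} | (F \subset edges C) &&
    `[< obtained_by_reversing_and_isolated b (Qunion ns) (spanning F) >]]%SET|
  in (N false)%:Z - (N true)%:Z.

Definition gammaC (l : nat) (C : ograph) : int :=
  if `[< obtained_by_reversing false (Dcycle l./2) C >] then 1 else -1.

Section kernels.
Context (R : realType).
Local Notation mR := (measurableTypeR R).
Local Notation I := (`[0%R, 1%R]%classic : set R).

Definition lebesgue01 : set mR -> \bar R :=
  mrestr (@lebesgue_measure R) (@measurable_itv R `[0, 1]).

HB.instance Definition _ := Measure.on lebesgue01.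

Fact lebesgue01_setT : lebesgue01 [set: mR] = 1%E.
Proof.
rewrite /lebesgue01 /mrestr setTI lebesgue_measure_itv /= lte_fin ltr01.
by rewrite -EFinB subr0.
Qed.

HB.instance Definition _ :=
  Measure_isProbability.Build _ _ _ lebesgue01 lebesgue01_setT.

Definition tuple_cons n (p : mR * n.-tuple mR) : n.+1.-tuple mR :=
  [tuple of p.1 :: p.2].

Fact measurable_tuple_cons n : measurable_fun setT (@tuple_cons n).
Proof. exact: measurable_cons. Qed.

HB.instance Definition _ n :=
  isMeasurableFun.Build _ _ _ _ (@tuple_cons n) (@measurable_tuple_cons n).

(* Lebesgue measure on [0,1]^n (seen as a measure on R^n concentrated on the
   cube): the n-fold product of [lebesgue01]. *)
Fixpoint cube_measure n : probability (n.-tuple mR) R :=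
  if n is m.+1 then
    distribution (lebesgue01 \x cube_measure m)%E (@tuple_cons m)
  else dirac [tuple].

Definition unit_cube n : set (n.-tuple mR) :=
  [set x | forall i, I (tnth x i)].

(* Kernels are functions on R * R of which only the values on the unit square
   are constrained and used. *)
Definition is_kernel (U : R -> R -> R) : Prop :=
  measurable_fun (I `*` I : set (mR * mR)) (fun p => U p.1 p.2) /\
  exists M : R, forall x y, I x -> I y -> `|U x y| <= M.

Definition antisymmetric_kernel (U : R -> R -> R) : Prop :=
  is_kernel U /\ forall x y, I x -> I y -> U x y = - U y x.

Definition tournamenton (W : R -> R -> R) : Prop :=
  [/\ is_kernel W, forall x y, I x -> I y -> 0 <= W x y &
      forall x y, I x -> I y -> W x y + W y x = 1].

(* The coordinate of a vertex is the one given by its rank. *)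
Definition hom_density (H : ograph) (U : R -> R -> R) : R :=
  (\int[cube_measure #|H|]_(x in @unit_cube #|H|)
    \prod_(e in edges H) U (tnth x (enum_rank e.1)) (tnth x (enum_rank e.2)))%R.

Definition quasirandom_forcing (H : ograph) : Prop :=
  forall W, tournamenton W -> hom_density H W = 2 ^- #|edges H| ->
  ae_eq (@lebesgue_measure R \x @lebesgue_measure R)%E (I `*` I)
    (fun p => W p.1 p.2) (fun=> 1 / 2).

(* The bounds k <= l and n_i <= l on the index ranges are implied by
   k + 2 n_1 + ... + 2 n_k <= l. *)
Definition cycle_form (l : nat) (C : ograph) (U : R -> R -> R) : R :=
  \sum_(k < l.+1 | (1 <= k)%N)
    \sum_(n : k.-tuple 'I_l.+1 |
      [&& all (fun i : 'I_l.+1 => 1 <= i)%N n,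
          sorted (fun i j : 'I_l.+1 => i <= j)%N n &
          (k + \sum_(i <- n) i.*2 <= l)%N])
      (alphaC C [seq val i | i <- n])%:~R / 2 ^+ (l - \sum_(i <- n) i.*2)%N
      * \prod_(i <- n) hom_density (Qpath i) U
  + (gammaC l C)%:~R * hom_density (Dcycle l./2) U.

End kernels.

(* Main.v *)
(** Write a tournamenton as [1/2 + U] with [U] antisymmetric and expand
    [t(C, 1/2 + U)] over the edge subsets [F] of [C].  A proper nonempty [F] is
    a disjoint union of paths: if one of them has odd length, reversing it shows
    that [t(C<F>, U) = 0]; otherwise [C<F>] is, up to reversals and isolated
    vertices, a union of [Q_{2n_i}] for exactly one multiset of lengths.  Hence
    [t(C, 1/2 + U) - 2^-l] is the form of the theorem.

    The rank two kernel [V(x,y) = c (a(x) b(y) - b(x) a(y))], with [a], [b]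
    orthogonal, of the same norm and of mean [0], has [t(Q_{2n}, V) = 0] and
    [t(D_l, V) > 0] for both signs of [c].  If [C] were quasirandom-forcing, the
    intermediate value theorem along the segments from [U] to [V] and from [U]
    to [-V] would give two points of these segments that vanish almost
    everywhere, which forces [V = 0] almost everywhere. *)

From HB Require Import structures.
Require Import Defs.
From mathcomp Require Import all_boot all_order all_algebra.
From mathcomp Require Import all_classical all_reals all_analysis.
From mathcomp Require Import measurable_realfun.
From mathcomp Require Import zify ring lra.

Set Implicit Arguments.
Unset Strict Implicit.
Unset Printing Implicit Defensive.

Import Order.TTheory GRing.Theory Num.Theory.
Import numFieldNormedType.Exports.

(** * Graphs up to reorientation *)

Section adjacency.
Implicit Types G H K : ograph.

(** For antisymmetric [U], reversing an edge only changes the sign of a density. The combinatorics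
    can therefore take place on underlying undirected graphs ([adj]), where being a reorientation is
    plain isomorphism. Parities never have to be computed: a graph that arises with both parities
    has a density equal to its own negative, hence 0.

    A single kernel [V] would not suffice. If [U] is a negative multiple of [V], the segment from
    [U] to [V] passes through the zero kernel, which is no contradiction to forcing; this cannot
    happen for [V] and [-V] at once.

    The operator of an antisymmetric kernel has imaginary spectrum. With [r] the common squared norm
    of [a] and [b], the nonzero eigenvalues of [V] are [i c r] and [- i c r]. Mean 0 makes the
    operator annihilate constants, which kills paths. The trace of its [l]-th power has sign
    [(-1)^(l/2)], and reversing half of a directed cycle to get D_l produces the same sign, so the
    two cancel. *)

Definition adj (G : ograph) : rel G :=
  fun u v => ((u, v) \in edges G) || ((v, u) \in edges G).

Definition adj_iso (G H : ograph) : Prop :=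
  exists2 f : G -> H, bijective f & forall u v, adj (f u) (f v) = adj u v.

Lemma adj_sym (G : ograph) : symmetric (@adj G).
Proof. by move=> u v; rewrite /adj orbC. Qed.

Lemma adj_iso_refl G : adj_iso G G.
Proof. by exists id => //; exists id. Qed.

Lemma adj_iso_sym G H : adj_iso G H -> adj_iso H G.
Proof.
move=> [f [g fK gK] fadj]; exists g; first by exists f.
by move=> u v; rewrite -fadj !gK.
Qed.

Lemma adj_iso_trans G H K : adj_iso G H -> adj_iso H K -> adj_iso G K.
Proof.
move=> [f fb fadj] [g gb gadj]; exists (g \o f); first exact: bij_comp.
by move=> u v; rewrite /= gadj fadj.
Qed.

Lemma adj_dunion_inl G H u v : @adj (dunion G H) (inl u) (inl v) = adj u v.
Proof. by rewrite /adj !inE. Qed.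

Lemma adj_dunion_inr G H u v : @adj (dunion G H) (inr u) (inr v) = adj u v.
Proof. by rewrite /adj !inE. Qed.

Lemma adj_dunion_inlr G H u v : @adj (dunion G H) (inl u) (inr v) = false.
Proof. by rewrite /adj !inE. Qed.

Lemma adj_dunion_inrl G H u v : @adj (dunion G H) (inr u) (inl v) = false.
Proof. by rewrite /adj !inE. Qed.

Definition adj_dunionE :=
  (adj_dunion_inl, adj_dunion_inr, adj_dunion_inlr, adj_dunion_inrl).

Lemma adj_edgeless m u v : @adj (edgeless m) u v = false.
Proof. by rewrite /adj !inE. Qed.

Lemma adj_iso_dunion G G' H H' :
  adj_iso G G' -> adj_iso H H' -> adj_iso (dunion G H) (dunion G' H').
Proof.
move=> [f [f' fK f'K] fadj] [g [g' gK g'K] gadj].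
exists (fun w => match w with inl u => inl (f u) | inr u => inr (g u) end).
  exists (fun w => match w with inl u => inl (f' u) | inr u => inr (g' u) end);
  by case=> u; rewrite ?fK ?f'K ?gK ?g'K.
by move=> [u|u] [v|v]; rewrite !adj_dunionE.
Qed.

Definition swap_dunion G H (w : dunion G H) : dunion H G :=
  match w with inl u => inr u | inr u => inl u end.

Lemma swap_dunion_bij G H : bijective (@swap_dunion G H).
Proof. by exists (@swap_dunion H G); case. Qed.

Lemma adj_swap_dunion G H (u v : dunion G H) :
  adj (swap_dunion u) (swap_dunion v) = adj u v.
Proof. by case: u v => [u|u] [v|v]; rewrite /= !adj_dunionE. Qed.

Lemma adj_iso_dunionC G H : adj_iso (dunion G H) (dunion H G).
Proof.
exists (@swap_dunion G H); first exact: swap_dunion_bij.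
exact: adj_swap_dunion.
Qed.

Lemma adj_iso_dunionA G H K :
  adj_iso (dunion (dunion G H) K) (dunion G (dunion H K)).
Proof.
exists (fun w : dunion (dunion G H) K => match w with
  | inl (inl u) => inl u | inl (inr u) => inr (inl u) | inr u => inr (inr u)
  end : dunion G (dunion H K)).
  exists (fun w => match w with
  | inl u => inl (inl u) | inr (inl u) => inl (inr u) | inr (inr u) => inr u
  end); first by case=> [[u|u]|u].
  by case=> [u|[u|u]].
by move=> [[u|u]|u] [[v|v]|v]; rewrite /= !adj_dunionE.
Qed.

Lemma adj_iso_dunionCA G H K :
  adj_iso (dunion G (dunion H K)) (dunion H (dunion G K)).
Proof.
apply: adj_iso_trans (adj_iso_sym (adj_iso_dunionA _ _ _)) _.
apply: adj_iso_trans (adj_iso_dunionA _ _ _).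
exact: adj_iso_dunion (adj_iso_dunionC _ _) (adj_iso_refl _).
Qed.

Lemma adj_iso_dunion_edgeless0 G : adj_iso (dunion (edgeless 0) G) G.
Proof.
exists (fun w : dunion (edgeless 0) G => match w with
  | inl u => match notF (ltn_ord u) with end | inr u => u end).
  by exists inr; [case=> // -[]|].
by move=> [[]//|u] [[]//|v]; rewrite adj_dunionE.
Qed.

Lemma adj_iso_edgelessD a b :
  adj_iso (dunion (edgeless a) (edgeless b)) (edgeless (a + b)).
Proof.
exists (@fintype.unsplit a b).
  by exists (@fintype.split a b); [exact: unsplitK|exact: splitK].
by move=> u v; rewrite adj_edgeless; case: u v => [u|u] [v|v];
  rewrite !adj_dunionE ?adj_edgeless.
Qed.

(** The set to reverse consists of the edges of [G] that [f] maps against the orientation of [H].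
    Only some parity can be promised, since adjacency does not determine it. *)
Lemma adj_iso_obtained G H : adj_iso G H -> exists b,
  obtained_by_reversing b G H.
Proof.
move=> [f fb fadj].
pose S := [set e in edges G | (f e.1, f e.2) \notin edges H]%SET.
exists (odd #|S|), S; split=> //.
  by apply/fintype.subsetP => e; rewrite inE => /andP[].
exists f => // u v; rewrite !inE /=.
have := fadj u v; rewrite /adj.
case uv: ((u, v) \in edges G); case vu: ((v, u) \in edges G);
  case fuv: ((f u, f v) \in edges H); case fvu: ((f v, f u) \in edges H) => //=;
  have := @edges_oriented G u v; have := @edges_oriented H (f u) (f v);
  rewrite uv vu fuv fvu => //= h1 h2; try by have := h1 isT;
    try by have := h2 isT.
Qed.

Lemma obtained_adj_iso b G H : obtained_by_reversing b G H -> adj_iso G H.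
Proof.
move=> [S [SE _ [f fb fE]]]; exists f => // u v; rewrite /adj !fE !inE /=.
by case: ((u, v) \in edges G); case: ((v, u) \in edges G);
   case: ((u, v) \in S); case: ((v, u) \in S).
Qed.

(** Orientedness makes the edge set disjoint from its transpose. Hence the number of edges can be
    read off adjacency and is invariant under [adj_iso]. *)
Lemma card_adj (G : ograph) :
  #|[set e : G * G | adj e.1 e.2]%SET| = (#|edges G|).*2.
Proof.
pose sw (e : G * G) := (e.2, e.1).
rewrite (_ : [set _ | _]%SET = edges G :|: sw @: edges G).
  rewrite cardsU (_ : _ :&: _ = finset.set0) ?cards0 ?subn0.
    by rewrite card_imset ?addnn//; apply: (can_inj (g := sw)) => -[].
  apply/finset.setP => -[u v]; rewrite !inE;
    apply/andP => -[uv] /imsetP[[a b] ab].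
  by case=> ? ?; subst; move: uv; rewrite (negbTE (edges_oriented ab)).
apply/finset.setP => -[u v]; rewrite !inE /adj /=; congr orb.
by apply/idP/imsetP => [vu|[[a b] ab [-> ->]]//]; exists (v, u).
Qed.

Lemma adj_iso_card_edges G H : adj_iso G H -> #|edges G| = #|edges H|.
Proof.
move=> [f [g fK gK] fadj]; apply: double_inj; rewrite -!card_adj.
pose ff (e : G * G) := (f e.1, f e.2).
have ffI : injective ff.
  by apply: (can_inj (g := fun e => (g e.1, g e.2))) => -[u v];
    rewrite /ff /= !fK.
rewrite -(card_imset _ ffI); apply: eq_card => -[u v]; rewrite !inE.
apply/imsetP/idP => [[[a b]]|uv]; first by rewrite inE => ab [-> ->] /=;
  rewrite fadj.
by exists (g u, g v); rewrite ?inE /ff /= ?gK// -fadj !gK.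
Qed.

Lemma adj_iso_card G H : adj_iso G H -> #|G| = #|H|.
Proof. by move=> [f /bij_eq_card]. Qed.

Lemma card_edges_dunion G H : #|edges (dunion G H)| =
  (#|edges G| + #|edges H|)%N.
Proof.
pose l (e : G * G) : dunion G H * dunion G H := (inl e.1, inl e.2).
pose r (e : H * H) : dunion G H * dunion G H := (inr e.1, inr e.2).
have lI : injective l by move=> [u v] [u' v'] [-> ->].
have rI : injective r by move=> [u v] [u' v'] [-> ->].
rewrite -(card_imset _ lI) -(card_imset _ rI) -cardsUI.
rewrite [X in (_ + #|pred_of_set X|)%N](_ : _ = finset.set0) ?cards0 ?addn0.
  apply: eq_card => -[[u|u] [v|v]]; rewrite !inE /=; apply/esym.
  - apply/orP/idP => [[]/imsetP[[a b]]//|uv].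
      by move=> ab [-> ->].
    by left; apply/imsetP; exists (u, v).
  - by apply/norP; split; apply/imsetP => -[[a b]].
  - by apply/norP; split; apply/imsetP => -[[a b]].
  - apply/orP/idP => [[]/imsetP[[a b]]//|uv].
      by move=> ab [-> ->].
    by right; apply/imsetP; exists (u, v).
apply/finset.setP => -[u v]; rewrite !inE;
  apply/andP => -[/imsetP[[a b] _ [-> _]]].
by move=> /imsetP[[c d] _ []].
Qed.

End adjacency.

(** * Component sizes as an isomorphism invariant *)

Section connectivity.
Implicit Types G H K : ograph.

Lemma adj_path_dunion_inl G H (u : G) (p : seq (dunion G H)) :
  path (@adj (dunion G H)) (inl u) p ->
  exists2 q, p = map inl q & path (@adj G) u q.
Proof.
elim: p u => [|w p IH] u /=; first by exists [::].
case: w => v; rewrite adj_dunionE => /andP[]// uv /IH[q -> vq].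
by exists (v :: q) => //=; rewrite uv.
Qed.

Lemma connect_adj_homo G H (f : G -> H) :
  (forall u v, adj u v -> adj (f u) (f v)) ->
  forall u v, connect (@adj G) u v -> connect (@adj H) (f u) (f v).
Proof.
move=> fadj u v /connectP[p up ->]; apply/connectP; exists (map f p).
  by rewrite path_map; apply: sub_path up => a b; exact: fadj.
by rewrite last_map.
Qed.

Lemma connect_dunion_inl G H (u v : G) :
  connect (@adj (dunion G H)) (inl u) (inl v) = connect (@adj G) u v.
Proof.
apply/idP/idP => [/connectP[p up]|].
  have [q -> uq] := adj_path_dunion_inl up.
  by rewrite last_map => -[->]; apply/connectP; exists q.
by apply: (connect_adj_homo (H := dunion G H)) => a b; rewrite adj_dunionE.
Qed.

Lemma connect_dunion_inlr G H (u : G) (v : H) :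
  connect (@adj (dunion G H)) (inl u) (inr v) = false.
Proof.
apply/negP => /connectP[p up].
by have [q -> uq] := adj_path_dunion_inl up; rewrite last_map.
Qed.

Lemma connect_adj_iso G H (f : G -> H) : bijective f ->
  (forall u v, adj (f u) (f v) = adj u v) ->
  forall u v, connect (@adj H) (f u) (f v) = connect (@adj G) u v.
Proof.
move=> [g fK gK] fadj u v; apply/idP/idP; last first.
  by apply: connect_adj_homo => a b; rewrite fadj.
move=> /(@connect_adj_homo _ _ g); rewrite !fK; apply=> a b.
by rewrite -[a in adj a _]gK -[b in adj _ b]gK fadj.
Qed.

(* An isomorphism invariant that recovers the multiset of path lengths of a
   union of paths. *)
Definition comp_count (s : nat) (G : ograph) : nat :=
  #|[pred v : G | #|connect (@adj G) v| == s]|.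

Lemma adj_iso_comp_count s G H : adj_iso G H -> comp_count s G = comp_count s H.
Proof.
move=> [f fb fadj]; have cf := connect_adj_iso fb fadj; have [g fK gK] := fb.
have fI := can_inj fK.
have comp u : #|connect (@adj H) (f u)| = #|connect (@adj G) u|.
  rewrite -(fintype.card_image fI); apply: eq_card => v.
  rewrite -[v]gK (mem_map fI) mem_enum; exact: cf.
rewrite /comp_count -(fintype.card_image fI); apply: eq_card => v.
by rewrite -[v]gK (mem_map fI) mem_enum !inE -[in LHS]comp.
Qed.

Lemma comp_count_dunion s G H :
  comp_count s (dunion G H) = (comp_count s G + comp_count s H)%N.
Proof.
have compl G1 H1 (u : G1) :
    #|connect (@adj (dunion G1 H1)) (inl u)| = #|connect (@adj G1) u|.
  rewrite -!sum1_card big_sumType/= [X in (_ + X)%N]big_pred0 ?addn0.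
    by apply: eq_bigl => v; exact: connect_dunion_inl.
  by move=> v; exact: connect_dunion_inlr.
(* The right summand is reduced to the left one through [swap_dunion]. *)
have compr (u : H) :
    #|connect (@adj (dunion G H)) (inr u)| = #|connect (@adj H) u|.
  rewrite -(compl H G u) -(fintype.card_image (bij_inj (@swap_dunion_bij H G))).
  apply: eq_card => v; have [g gK Kg] := @swap_dunion_bij H G; rewrite -[v]Kg.
  rewrite (mem_map (bij_inj (@swap_dunion_bij H G))) mem_enum.
  apply: etrans (connect_adj_iso (@swap_dunion_bij H G) _ (inl u) (g v)) => //.
  exact: adj_swap_dunion.
rewrite /comp_count -!sum1_card big_sumType/=.
congr addn; apply: eq_bigl => u; rewrite !inE.
  by rewrite -(compl G H).
by rewrite -compr.
Qed.

Lemma comp_count_edgeless s m : comp_count s (edgeless m) = (m * (s == 1))%N.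
Proof.
rewrite /comp_count (eq_card (B := [pred _ : edgeless m | s == 1%N]));
  last first.
  move=> u; rewrite !inE eq_sym -[1%N](card1 u); congr (s == _).
  apply: eq_card => v; rewrite !inE; apply/connectP/eqP => [[[|w p]]/=|->].
  - by move=> _ ->.
  - by rewrite adj_edgeless.
  - by exists [::].
case: (s == 1%N); rewrite ?muln1 ?muln0.
  by rewrite -[RHS]card_ord; apply: eq_card.
by apply: eq_card0.
Qed.

Lemma comp_count_connected s (G : ograph) :
  (forall u v, connect (@adj G) u v) -> comp_count s G = (#|G| * (s == #|G|))%N.
Proof.
move=> cG; rewrite /comp_count (eq_card (B := [pred _ : G | s == #|G|]));
  last first.
  move=> u; rewrite !inE eq_sym; congr (s == _); apply: eq_card => v.
  exact: cG.
case: (s == #|G|); rewrite ?muln1 ?muln0; first exact: eq_card.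
exact: eq_card0.
Qed.

End connectivity.

(** * Paths, unions of paths, and graphs laid out on a line *)

Section linear_graphs.
Implicit Types (G H K : ograph) (b : pred nat).

(** Models a cycle cut open at a missing edge, with [b] telling which steps are present. As [b]
    lives on [nat], dropping an initial segment is a mere shift of [b]. *)
Definition lin_edges N (b : pred nat) : {set 'I_N * 'I_N} :=
  [set e : 'I_N * 'I_N | (e.2 == e.1.+1 :> nat) && b e.1].

Fact lin_oriented N b u v : (u, v) \in @lin_edges N b -> (v, u) \notin lin_edges
  N b.
Proof. by rewrite !inE /=; lia. Qed.

Definition lin N b : ograph := OGraph (@lin_oriented N b).

Definition dipath m : ograph := lin m.+1 xpredT.

Lemma adj_lin N b (i j : 'I_N) : @adj (lin N b) i j =
  ((j == i.+1 :> nat) && b i) || ((i == j.+1 :> nat) && b j).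
Proof. by rewrite /adj !inE. Qed.

(** The first path stops at vertex [m] either because the next edge is missing or because no vertex
    is left, which is the alternative [N == 0]. *)
Lemma lin_split m N b : (forall i, (i < m)%N -> b i) -> ~~ b m || (N == 0)%N ->
  adj_iso (dunion (dipath m) (lin N (fun i => b (m.+1 + i)%N)))
    (lin (m.+1 + N) b).
Proof.
move=> bm bN; exists (@fintype.unsplit m.+1 N).
  by exists (@fintype.split m.+1 N); [exact: unsplitK|exact: splitK].
have bS (i : 'I_m.+1) : (i.+1 <= m)%N -> b i by exact: bm.
move=> [u|u] [v|v]; rewrite adj_dunionE ?adj_lin /=.
- have := ltn_ord u; have := ltn_ord v; have := bS u; have := bS v; lia.
- have := ltn_ord u; have := ltn_ord v; have := bS u.
  have [->|um] := eqVneq (u : nat) m; last lia.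
  by case: (b m) bN => //= N0; lia.
- have := ltn_ord u; have := ltn_ord v; have := bS v.
  have [->|um] := eqVneq (v : nat) m; last lia.
  by case: (b m) bN => //= N0; lia.
- have e (i j : nat) : (m.+1 + i == (m.+1 + j).+1)%N = (i == j.+1)%N by lia.
  by rewrite !e.
Qed.

Definition dipath_edge m (i : 'I_m) : 'I_m.+1 * 'I_m.+1 :=
  (widen_ord (leqnSn m) i, lift ord0 i).

Lemma dipath_edge_inj m : injective (@dipath_edge m).
Proof. by move=> i j [/val_inj]. Qed.

Lemma edges_dipathE m :
  edges (dipath m) = (@dipath_edge m @: [set: 'I_m])%SET.
Proof.
apply/finset.setP => -[u v].
rewrite !inE andbT /=; apply/eqP/imsetP => [vu|[i _ [-> ->]]//].
have um : (u < m)%N by have := ltn_ord v; lia.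
by exists (Ordinal um); rewrite ?inE //; congr pair; apply: val_inj.
Qed.

Lemma card_edges_dipath m : #|edges (dipath m)| = m.
Proof.
by rewrite edges_dipathE (card_imset _ (@dipath_edge_inj m)) cardsT card_ord.
Qed.

(** Reading the vertices backwards undoes the reversal of all [m] edges. For odd [m] this makes the
    density of the path its own negative. *)
Lemma dipath_reverse m : obtained_by_reversing (odd m) (dipath m) (dipath m).
Proof.
exists (edges (dipath m)); split=> //; first by rewrite card_edges_dipath.
exists (@rev_ord m.+1); first by exists (@rev_ord m.+1); exact: rev_ordK.
by move=> u v; rewrite !inE /= !andbT; have := ltn_ord u; have := ltn_ord v;
  lia.
Qed.

Lemma Qpath_dipath n : adj_iso (Qpath n) (dipath n.*2).
Proof.
exists id; first by exists id.
by move=> u v; rewrite /adj !inE /= !andbT; lia.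
Qed.

Lemma dipath_connect m (u v : dipath m) : connect (@adj (dipath m)) u v.
Proof.
have c0 (w : dipath m) : connect (@adj (dipath m)) ord0 w.
  case: w; elim=> [|i IH] im.
    by rewrite (_ : Ordinal _ = ord0) ?connect0//; exact: val_inj.
  apply: connect_trans (IH (ltnW im)) _.
  by apply: connect1; rewrite adj_lin /= eqxx.
apply: connect_trans (c0 v); rewrite (sym_connect_sym (@adj_sym (dipath m))).
exact: c0.
Qed.

Lemma dipath0_edgeless1 : adj_iso (dipath 0) (edgeless 1).
Proof.
exists id; first by exists id.
by move=> u v; rewrite adj_edgeless adj_lin !ord1.
Qed.

Lemma comp_count_Qunion s ns m :
  comp_count s (dunion (Qunion ns) (edgeless m)) =
  (\sum_(n <- ns) n.*2.+1 * (s == n.*2.+1) + m * (s == 1))%N.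
Proof.
rewrite comp_count_dunion comp_count_edgeless; congr addn.
elim: ns => [|n ns IH]; first by rewrite big_nil comp_count_edgeless.
rewrite big_cons /= comp_count_dunion IH; congr addn.
rewrite (adj_iso_comp_count _ (Qpath_dipath n)) comp_count_connected
  ?card_ord//.
exact: dipath_connect.
Qed.

(** For [n >= 1], the components of size [2n+1] contain [2n+1] vertices for each occurrence of [n],
    and isolated vertices, of size 1, do not interfere. So the isomorphism class determines all
    multiplicities, and these determine a sorted list. *)
Lemma Qunion_inj ns ns' m m' :
  all (leq 1) ns -> all (leq 1) ns' -> sorted leq ns -> sorted leq ns' ->
  adj_iso (dunion (Qunion ns) (edgeless m)) (dunion (Qunion ns') (edgeless m'))
    ->
  ns = ns'.
Proof.
move=> ns0 ns'0 nss ns's iso.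
apply: (sorted_eq leq_trans anti_leq) => //.
(* For [n = 0] the size [2n+1] is that of an isolated vertex and carries no information, but neither
   list contains 0. *)
apply/allP => n _; apply/eqP; have [->|n0] := posnP n.
  rewrite (count_memPn _) ?(count_memPn _)//.
    by apply/negP => /(allP ns'0).
  by apply/negP => /(allP ns0).
have sumE (s : seq nat) k : (\sum_(i <- s) i.*2.+1 * (n.*2.+1 == i.*2.+1) +
    k * (n.*2.+1 == 1) = n.*2.+1 * count_mem n s)%N.
  have -> : (n.*2.+1 == 1)%N = false by lia.
  rewrite muln0 addn0; elim: s => [|i s IH]; first by rewrite big_nil muln0.
  rewrite big_cons IH /= mulnDr; congr addn.
  have [->|ni] := eqVneq i n; first by rewrite eqxx.
  by rewrite (_ : (_ == _) = false) ?muln0//; lia.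
have := adj_iso_comp_count n.*2.+1 iso.
rewrite !comp_count_Qunion !sumE.
by move=> /eqP; rewrite eqn_mul2l => /orP[//|/eqP].
Qed.

Lemma Qunion_perm ns ns' : perm_eq ns ns' -> adj_iso (Qunion ns) (Qunion ns').
Proof.
elim: ns ns' => [|n ns IH] ns' p.
  by move: p; rewrite perm_sym => /perm_nilP ->; exact: adj_iso_refl.
have : n \in ns' by rewrite -(perm_mem p) mem_head.
move=> /path.splitPr nns'; case: nns' p => s1 s2.
rewrite perm_sym -cat1s perm_catCA /= perm_cons perm_sym => /IH iso.
apply: adj_iso_trans (adj_iso_dunion (adj_iso_refl _) iso) _.
elim: s1 {iso} => [|i s1 IH1]; first exact: adj_iso_refl.
apply: adj_iso_trans (adj_iso_dunionCA _ _ _) _.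
exact: adj_iso_dunion (adj_iso_refl _) IH1.
Qed.

(** Peel off the longest initial path and recurse on the rest. A path of odd length settles the
    first alternative, a lone vertex joins the isolated ones, and a path of positive even length
    adds half its length to [ns]. *)
Lemma lin_components N b :
  (exists m G, odd m /\ adj_iso (dunion (dipath m) G) (lin N b)) \/
  (exists ns k, [/\ all (leq 1) ns, sorted leq ns &
     adj_iso (dunion (Qunion ns) (edgeless k)) (lin N b)]).
Proof.
(* The order of [ns] is ignored in the induction and restored by sorting, thanks to
   [Qunion_perm]. *)
suff : (exists m G, odd m /\ adj_iso (dunion (dipath m) G) (lin N b)) \/
  (exists ns k, all (leq 1) ns /\
     adj_iso (dunion (Qunion ns) (edgeless k)) (lin N b)).
  move=> [|[ns [k [ns1 iso]]]]; [by left|right].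
  exists (sort leq ns), k; split.
  - by rewrite all_sort.
  - exact: (sort_sorted leq_total).
  apply: adj_iso_trans iso; apply: adj_iso_dunion (adj_iso_refl _).
  by apply: Qunion_perm; rewrite perm_sort.
have [n] := ubnP N; elim: n N b => // n IH [|N] b Nn.
  right; exists [::], 0; split=> //.
  apply: adj_iso_trans (adj_iso_dunion_edgeless0 _) _.
  by exists id; [exists id|move=> -[]].
(* The least such [m] is the length of the initial path: either the edge after [m] is missing, or
   [m] is the last vertex [N]. *)
have ex_m : exists m, ~~ b m || (N <= m)%N by exists N; rewrite leqnn orbT.
case: (ex_minnP ex_m) => m bm m_min.
have mN : (m <= N)%N by apply: m_min; rewrite leqnn orbT.
have blt i : (i < m)%N -> b i.
  by apply: contraTT => bi; rewrite -leqNgt; apply: m_min; rewrite bi.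
have N_eq : (m.+1 + (N - m) = N.+1)%N by rewrite addSn subnKC.
have {}bm : ~~ b m || (N - m == 0)%N by rewrite subn_eq0.
have := lin_split blt bm; set b' := fun i => _; rewrite N_eq => split_iso.
case: (boolP (odd m)) => [om|em].
  by left; exists m, (lin (N - m) b').
have [|[m' [G [om' iso]]]|[ns [k [ns1 iso]]]] := IH (N - m)%N b'; first by lia.
  left; exists m', (dunion (dipath m) G); split=> //.
  apply: adj_iso_trans (adj_iso_dunionCA _ _ _) _.
  exact: adj_iso_trans (adj_iso_dunion (adj_iso_refl _) iso) split_iso.
right; have [m0|m0] := posnP m.
  exists ns, k.+1; split=> //.
  apply: adj_iso_trans split_iso.
  apply: adj_iso_trans (adj_iso_dunion (adj_iso_refl _) iso).
  apply: adj_iso_trans (adj_iso_dunionCA _ _ _).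
  apply: adj_iso_dunion (adj_iso_refl _) _; rewrite m0.
  apply: adj_iso_trans (adj_iso_dunion (adj_iso_sym dipath0_edgeless1)
    (adj_iso_refl _)).
  exact: adj_iso_sym (adj_iso_edgelessD 1 k).
exists (m./2 :: ns), k; split; first by rewrite /= ns1 andbT; lia.
apply: adj_iso_trans split_iso.
apply: adj_iso_trans (adj_iso_dunion (adj_iso_refl _) iso).
apply: adj_iso_trans (adj_iso_dunionA _ _ _) _.
apply: adj_iso_dunion (adj_iso_refl _).
by apply: adj_iso_trans (Qpath_dipath _) _; rewrite even_halfK//;
  exact: adj_iso_refl.
Qed.

Lemma card_Qunion ns m :
  #|dunion (Qunion ns) (edgeless m)| = (size ns + \sum_(i <- ns) i.*2 + m)%N.
Proof.
rewrite card_sum card_ord; congr addn.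
elim: ns => [|n ns IH]; first by rewrite big_nil card_ord.
by rewrite big_cons /= card_sum card_ord IH /=; lia.
Qed.

Lemma card_edges_Qunion ns m :
  #|edges (dunion (Qunion ns) (edgeless m))| = (\sum_(i <- ns) i.*2)%N.
Proof.
apply: etrans (card_edges_dunion _ _) _; rewrite cards0 addn0.
elim: ns => [|n ns IH]; first by rewrite big_nil cards0.
rewrite big_cons; apply: etrans (card_edges_dunion _ _) _; rewrite IH.
by rewrite (adj_iso_card_edges (Qpath_dipath n)) card_edges_dipath.
Qed.

End linear_graphs.

(** * Cycles and their proper spanning subgraphs *)

Section cycles.
Context (l : nat) (C : ograph) (C_cycle : cycle_orientation l C).

Lemma cycle_Dcycle : ~~ odd l -> adj_iso (Dcycle l./2) C.
Proof.
move=> el; have [l3 [f fb fadj]] := C_cycle.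
have ll : l./2.*2 = l by rewrite even_halfK.
exists (f \o cast_ord ll).
  by apply: bij_comp => //; exists (cast_ord (esym ll)) => i; apply: val_inj.
have modE (i : 'I_l./2.*2) : (i.+1 %% l = if i.+1 == l then 0 else i.+1)%N.
  have := ltn_ord i; case: eqP => [->|] *; first by rewrite modnn.
  by rewrite modn_small; lia.
move=> u v; rewrite {1}/adj fadj /adj !inE /= !modE.
have := ltn_ord u; have := ltn_ord v.
by case: (u.+1 =P l); case: (v.+1 =P l); lia.
Qed.

(** Numbering the vertices from just after a missing edge makes the wrap-around pair non-adjacent,
    so that only consecutive numbers can be adjacent. *)
Lemma spanning_proper_lin (F : {set C * C}) :
  F \subset edges C -> F != edges C -> exists b, adj_iso (lin l b) (spanning F).
Proof.
move=> FE FnE; have [l3 [f [f' fK f'K] fadj]] := C_cycle.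
have l0 : (0 < l)%N by lia.
have [e eE eF] : exists2 e, e \in edges C & e \notin F.
  by apply/subsetPn; apply: contra FnE => EF; rewrite finset.eqEsubset FE.
pose S := spanning F.
have adjS u v : @adj S u v -> @adj C u v.
  by rewrite /adj !inE => /orP[] /andP[-> _]; rewrite ?orbT.
(* The missing edge may run along [f] or against it; [i0] is its end from which the other end is one
   step forward. *)
have [i0 i0P] : exists i0 : 'I_l, forall i j : 'I_l, i = i0 ->
    (j = i.+1 %% l :> nat)%N -> @adj S (f i) (f j) = false.
  case: e eE eF => u v uvE uvF.
  have nadj : @adj S u v = false.
    by rewrite /adj !inE uvE (negbTE uvF) /= (negbTE (edges_oriented uvE)).
  have nadj' : @adj S v u = false by rewrite adj_sym.
  have := fadj (f' u) (f' v); rewrite !f'K uvE /= => /esym/orP[]/eqP uv.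
    exists (f' u) => i j -> jE; rewrite (_ : j = f' v) ?f'K//.
    by apply: val_inj; rewrite /= jE uv.
  exists (f' v) => i j -> jE; rewrite (_ : j = f' u) ?f'K//.
  by apply: val_inj; rewrite /= jE uv.
(* The new number 0 is given to the successor of [i0], so the last number goes to [i0]. *)
pose r k : 'I_l := Ordinal (ltn_pmod (i0.+1 + k) l0).
pose g (k : 'I_l) : S := f (r k).
pose b k := @adj S (f (r k)) (f (r k.+1)).
have gE (i j : 'I_l) : (j == (r i).+1 %% l :> nat)%N = (j == r i.+1 :> nat).
  by rewrite /= -(addn1 ((i0.+1 + i) %% l)) modnDml addn1 addnS.
have rK (i j : 'I_l) : (r i == r j :> nat) = (i == j :> nat).
  by rewrite /= eqn_modDl !modn_small.
exists b, g.
  apply: inj_card_bij; last first.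
    by rewrite -(bij_eq_card (Bijective fK f'K)).
  move=> i j /(can_inj fK) /eqP.
  by rewrite -val_eqE rK val_eqE => /eqP.
have half (i j : 'I_l) : (r j == (r i).+1 %% l :> nat)%N ->
    @adj S (g i) (g j) = (j == i.+1 :> nat) && b i.
  rewrite gE => rji; have [ji|ji] := eqVneq (j : nat) i.+1.
    by rewrite /b /g (_ : r j = r i.+1)//; apply: val_inj; exact/eqP.
  (* Here [j] follows [i] only cyclically, so [i] is the last number and the pair is the missing
     edge. *)
  have il : i = l.-1 :> nat.
    have := ltn_ord i; have := ltn_ord j.
    move: rji; rewrite /= eqn_modDl.
    have [il|il|il] := ltngtP i.+1 l; try lia.
    by rewrite !modn_small// => /eqP; lia.
  apply: i0P; last by apply/eqP; rewrite gE.
  apply: val_inj; rewrite /= il addSn -addnS prednK// modnDr modn_small//.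
move=> i j; rewrite adj_lin.
have [ji|ji] := eqVneq (j : nat) i.+1.
  rewrite (half i j) ?gE ?rK ?ji// eqxx.
  by rewrite (_ : (i == i.+2 :> nat) = false) ?orbF//; lia.
have [ij|ij] := eqVneq (i : nat) j.+1.
  by rewrite adj_sym (half j i) ?gE ?rK ?ij// eqxx.
apply: contraNF ji => aij; move: (aij) => /adjS.
rewrite /adj fadj => /orP[/half|/half]; first by rewrite aij => /esym/andP[].
by rewrite adj_sym aij (negbTE ij).
Qed.
End cycles.

Local Open Scope classical_set_scope.
Local Open Scope ring_scope.

(** * Integration on the cube *)

(** Such functions are integrable for every probability measure and are closed under sums, products
    and sections, so linearity and Fubini need no other side condition. *)
Definition bounded_measurable d (T : measurableType d) (R : realType)
    (f : T -> R) : Prop :=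
  measurable_fun setT f /\ exists M, forall x, `|f x| <= M.

Section bounded_measurable.
Context d (T : measurableType d) (R : realType).
Implicit Types f g : T -> R.

Lemma bounded_measurable_cst (r : R) :
  bounded_measurable (fun _ : T => r).
Proof. by split; [exact: measurable_cst | exists `|r|]. Qed.

Lemma bounded_measurableD f g : bounded_measurable f -> bounded_measurable g ->
  bounded_measurable (fun x => f x + g x).
Proof.
move=> [mf [M fM]] [mg [N gN]]; split; first exact: measurable_funD.
by exists (M + N) => x; rewrite (le_trans (ler_normD _ _))// lerD.
Qed.

Lemma bounded_measurableM f g : bounded_measurable f -> bounded_measurable g ->
  bounded_measurable (fun x => f x * g x).
Proof.
move=> [mf [M fM]] [mg [N gN]]; split; first exact: measurable_funM.
by exists (M * N) => x; rewrite normrM ler_pM.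
Qed.

Lemma bounded_measurableZ (r : R) f : bounded_measurable f ->
  bounded_measurable (fun x => r * f x).
Proof. exact/bounded_measurableM/bounded_measurable_cst. Qed.

Lemma bounded_measurable_prod (J : Type) (s : seq J) (Q : pred J)
    (f : J -> T -> R) : (forall j, bounded_measurable (f j)) ->
  bounded_measurable (fun x => \prod_(j <- s | Q j) f j x).
Proof.
move=> bf; elim: s => [|j s IH].
  by under eq_fun do rewrite big_nil; exact: bounded_measurable_cst.
under eq_fun => x do rewrite big_cons.
by case: (Q j) => //; exact: bounded_measurableM.
Qed.

Lemma bounded_measurable_comp d' (T' : measurableType d') (h : T' -> T) f :
  measurable_fun setT h -> bounded_measurable f ->
  bounded_measurable (f \o h).
Proof.
move=> mh [mf [M fM]]; split; first exact: measurableT_comp.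
by exists M => x; exact: fM.
Qed.

Context (P : probability T R).

Lemma bounded_measurable_integrable f :
  bounded_measurable f -> P.-integrable setT (EFin \o f).
Proof.
move=> [mf [M fM]]; apply: measurable_bounded_integrable => //.
- by rewrite [X in (X < _)%E]probability_setT ltry.
- exists M; split; first exact: num_real.
  by move=> N /ltW MN x _; exact: le_trans (fM x) MN.
Qed.

Lemma EFin_expect f : bounded_measurable f ->
  (\int[P]_x f x)%:E = (\int[P]_x (f x)%:E)%E.
Proof.
move=> bf; rewrite fineK//; apply: integrable_fin_num => //.
exact: bounded_measurable_integrable.
Qed.

Lemma expect_cst (r : R) : \int[P]_x r = r.
Proof.
by rewrite Rintegral_cst// [X in fine X]probability_setT mulr1.
Qed.

Lemma expectZl (r : R) f : bounded_measurable f ->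
  \int[P]_x (r * f x) = r * \int[P]_x f x.
Proof. by move=> /bounded_measurable_integrable; exact: RintegralZl. Qed.

Lemma expectD f g : bounded_measurable f -> bounded_measurable g ->
  \int[P]_x (f x + g x) = \int[P]_x f x + \int[P]_x g x.
Proof.
by move=> bf bg; apply: RintegralD => //; exact: bounded_measurable_integrable.
Qed.

Lemma bounded_measurable_sum (J : Type) (s : seq J) (Q : pred J)
    (f : J -> T -> R) : (forall j, bounded_measurable (f j)) ->
  bounded_measurable (fun x => \sum_(j <- s | Q j) f j x).
Proof.
move=> bf; elim: s => [|j s IH].
  by under eq_fun do rewrite big_nil; exact: bounded_measurable_cst.
under eq_fun => x do rewrite big_cons.
by case: (Q j) => //; exact: bounded_measurableD.
Qed.

Lemma expect_sum (J : Type) (s : seq J) (Q : pred J) (f : J -> T -> R) :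
  (forall j, bounded_measurable (f j)) ->
  \int[P]_x (\sum_(j <- s | Q j) f j x) = \sum_(j <- s | Q j) \int[P]_x f j x.
Proof.
move=> bf; elim: s => [|j s IH].
  by under eq_Rintegral do rewrite big_nil; rewrite expect_cst big_nil.
under eq_Rintegral => x _ do rewrite big_cons.
rewrite big_cons -IH; case: (Q j) => //; rewrite expectD//;
  exact: bounded_measurable_sum.
Qed.

End bounded_measurable.

Lemma expect_distribution d d' (T : measurableType d) (T' : measurableType d')
    (R : realType) (P : probability T R) (X : {mfun T >-> T'}) (f : T' -> R) :
  bounded_measurable f ->
  \int[distribution P X]_y f y = \int[P]_x f (X x).
Proof.
move=> bf; congr fine; rewrite [LHS]integral_distribution//.
- by apply/measurable_EFinP; case: bf.
- apply: (@bounded_measurable_integrable _ _ _ P (f \o X)).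
  exact: bounded_measurable_comp.
Qed.

Section fubini.
Context d1 d2 (T1 : measurableType d1) (T2 : measurableType d2) (R : realType).
Context (P1 : probability T1 R) (P2 : probability T2 R).

Lemma bounded_measurable_section (f : T1 * T2 -> R) x :
  bounded_measurable f -> bounded_measurable (fun y => f (x, y)).
Proof.
move=> bf; apply: (@bounded_measurable_comp _ _ _ _ _ (fun y => (x, y))) => //.
exact: measurable_fun_pair.
Qed.

Lemma expect_prod (f : T1 * T2 -> R) : bounded_measurable f ->
  \int[(P1 \x P2)%E]_z f z = \int[P1]_x \int[P2]_y f (x, y).
Proof.
move=> bf; rewrite /Rintegral.
have := @bounded_measurable_integrable _ _ _ (P1 \x P2)%E _ bf.
move=> /integral12_prod_meas1 <-; congr fine; apply: eq_integral => x _.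
by rewrite [RHS](EFin_expect P2 (bounded_measurable_section x bf)).
Qed.

Lemma expect_prodM (f : T1 -> R) (g : T2 -> R) :
  bounded_measurable f -> bounded_measurable g ->
  \int[(P1 \x P2)%E]_z (f z.1 * g z.2) = \int[P1]_x f x * \int[P2]_y g y.
Proof.
move=> bf bg; rewrite expect_prod/=; last first.
  apply: bounded_measurableM; exact: bounded_measurable_comp.
under eq_Rintegral do rewrite expectZl//.
rewrite RintegralZr//; exact: bounded_measurable_integrable.
Qed.

End fubini.

Section cube.
Context (R : realType).
Local Notation mR := (measurableTypeR R).
Local Notation I := (`[0%R, 1%R]%classic : set R).
Local Notation la := (@lebesgue01 R).

Definition box n (A : 'I_n -> set mR) : set (n.-tuple mR) :=
  [set x | forall i, A i (tnth x i)].

Lemma box_bigcap n (A : 'I_n -> set mR) :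
  box A = \bigcap_(i in [set: 'I_n]) ((@tnth n mR ^~ i) @^-1` A i).
Proof. by apply/seteqP; split=> x /= xA i; [move=> _|]; exact: xA. Qed.

Lemma measurable_box n (A : 'I_n -> set mR) :
  (forall i, measurable (A i)) -> measurable (box A).
Proof.
move=> mA; rewrite box_bigcap; apply: fin_bigcap_measurable => // i _.
by rewrite -[X in measurable X]setTI; apply: measurable_tnth.
Qed.

Lemma cube_measure_box n (A : 'I_n -> set mR) :
  (forall i, measurable (A i)) ->
  cube_measure R n (box A) = (\prod_(i < n) la (A i))%E.
Proof.
elim: n A => [|n IH] A mA.
  by rewrite big_ord0 /= diracE mem_set// => -[].
rewrite big_ord_recl -IH//= /distribution /pushforward /=.
rewrite (_ : _ @^-1` _ = A ord0 `*` box (fun i => A (lift ord0 i))).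
  by rewrite product_measure1E//; exact: measurable_box.
apply/seteqP; split=> -[x y] /=.
- move=> xyA; split; first exact: (xyA ord0).
  by move=> i; have := xyA (lift ord0 i); rewrite tnthS.
- case=> xA yA i; have [j ->|->] := unliftP ord0 i; last exact: xA.
  by rewrite tnthS; exact: yA.
Qed.

(** Boxes are stable under intersection and generate the sigma-algebra of tuples, so agreement on
    boxes propagates to all measurable sets. *)
Lemma cube_measure_unique n (m : {measure set (n.-tuple mR) -> \bar R}) :
  (forall A : 'I_n -> set mR, (forall i, measurable (A i)) ->
     m (box A) = (\prod_(i < n) la (A i))%E) ->
  forall B, measurable B -> cube_measure R n B = m B.
Proof.
move=> mbox B mB.
pose G := [set C | exists2 A : 'I_n -> set mR,
  forall i, measurable (A i) & C = box A].
apply: (measure_unique G (fun=> setT)) => //.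
- apply/seteqP; split.
  + move=> C; apply: smallest_sub; first exact: smallest_sigma_algebra.
    move=> D; rewrite -bigcup_seq => -[i /= _ [A mA <-]].
    (* A condition on one coordinate is a box whose other sides are full. *)
    apply: sub_sigma_algebra; exists (fun j => if j == i then A else setT).
      by move=> j; case: ifP.
    rewrite setTI; apply/seteqP; split=> x /=.
      by move=> xA j; case: eqP => [->|].
    by move=> /(_ i); rewrite eqxx.
  + apply: smallest_sub; first exact: sigma_algebra_measurable.
    by move=> _ [A mA ->]; exact: measurable_box.
- move=> _ _ [A mA ->] [A' mA' ->]; exists (fun i => A i `&` A' i).
    by move=> i; exact: measurableI.
  apply/seteqP; split=> x /=; first by move=> [xA xA'] i; split.
  by move=> xAA; split=> i; case: (xAA i).
- by move=> _; exists (fun=> setT) => //; apply/seteqP; split.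
- by rewrite bigcup_const.
- by move=> _ [A mA ->]; exact: etrans (cube_measure_box mA) (esym (mbox A mA)).
- by move=> _; rewrite [X in (X < _)%E]probability_setT ltry.
Qed.

(** Reduces a change of variables to a check on boxes. Relabelling vertices, joining two independent
    blocks and passing to ordinal vertices are all instances. *)
Lemma expect_cube_transfer d (T : measurableType d) (P : probability T R) n
    (h : T -> n.-tuple mR) (f : n.-tuple mR -> R) :
  measurable_fun setT h ->
  (forall A : 'I_n -> set mR, (forall i, measurable (A i)) ->
     P (h @^-1` box A) = (\prod_(i < n) la (A i))%E) ->
  bounded_measurable f ->
  \int[cube_measure R n]_x f x = \int[P]_x f (h x).
Proof.
move=> mh Ph bf.
pose X : {mfun T >-> n.-tuple mR} :=
  HB.pack h (isMeasurableFun.Build _ _ _ _ h mh).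
rewrite -(@expect_distribution _ _ _ _ _ P X)//.
congr fine; apply: eq_measure_integral => B mB _.
exact: (@cube_measure_unique _ (distribution P X)).
Qed.

Lemma cube_measure_unit_cube n : cube_measure R n (@unit_cube R n) = 1%E.
Proof.
apply: etrans (@cube_measure_box n (fun=> I) _) _ => //.
rewrite big1// => i _; rewrite /lebesgue01 /mrestr setIid.
by rewrite lebesgue_measure_itv /= lte_fin ltr01 -EFinB subr0.
Qed.

(** The complement of the unit cube is null for [cube_measure]. As [f] has to be bounded and
    measurable everywhere, kernels given on the square are extended by [clamp] further on. *)
Lemma expect_unit_cube n (f : n.-tuple mR -> R) : bounded_measurable f ->
  \int[cube_measure R n]_(x in @unit_cube R n) f x =
    \int[cube_measure R n]_x f x.
Proof.
move=> bf.
have mI : measurable (@unit_cube R n) by exact: (@measurable_box n (fun=> I)).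
rewrite -[in RHS](setUv (@unit_cube R n)) Rintegral_setU//.
- rewrite [X in _ + X](_ : _ = 0) ?addr0// /Rintegral null_set_integral//.
  + exact: measurableC.
  + by apply: measurable_funTS; apply/measurable_EFinP; case: bf.
  + apply: etrans (probability_setC (cube_measure R n) mI) _.
    by rewrite [X in (1 - X)%E]cube_measure_unit_cube subee.
- exact: measurableC.
- by rewrite setUv; exact: bounded_measurable_integrable.
- by apply/disj_setPS => x [].
Qed.

End cube.

(** * Homomorphism densities *)

Section coordinates.
Context (R : realType).
Local Notation mR := (measurableTypeR R).

Definition coords (T : finType) (x : #|T|.-tuple mR) (v : T) : mR :=
  tnth x (enum_rank v).

(** Takes functions of vertex assignments, which hides the ranks through which [hom_density]
    addresses coordinates. *)
Definition expect_coords (T : finType) (F : (T -> mR) -> R) : R :=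
  \int[cube_measure R #|T|]_x F (coords x).

Definition bounded_measurable_coords (T : finType) (F : (T -> mR) -> R) :=
  bounded_measurable (fun x : #|T|.-tuple mR => F (coords x)).

Lemma expect_coords_reindex (S T : finType) (g : S -> T) (F : (S -> mR) -> R) :
  bijective g -> bounded_measurable_coords F ->
  expect_coords F = expect_coords (fun x => F (x \o g)).
Proof.
move=> [g' gK g'K] bF; rewrite /expect_coords.
pose h (x : #|T|.-tuple mR) : #|S|.-tuple mR :=
  [tuple coords x (g (enum_val i)) | i < #|S|].
rewrite (@expect_cube_transfer R _ _ (cube_measure R #|T|) #|S| h)//.
- apply: eq_Rintegral => x _; congr F; apply/funext => v.
  by rewrite /coords tnth_mktuple enum_rankK.
- apply/measurable_fun_tnthP => i.
  rewrite (_ : _ \o _ = fun x => coords x (g (enum_val i))); last first.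
    by apply/funext => x; rewrite /= tnth_mktuple.
  exact: measurable_tnth.
- move=> A mA.
  rewrite (_ : _ @^-1` _ = box (fun j => A (enum_rank (g' (enum_val j))))).
    rewrite [LHS]cube_measure_box//.
    rewrite (reindex (fun i : 'I_#|S| => enum_rank (g (enum_val i))))/=.
      by apply: eq_bigr => i _; rewrite enum_rankK gK enum_valK.
    exists (fun i => enum_rank (g' (enum_val i))) => i _.
      by rewrite enum_rankK gK enum_valK.
    by rewrite enum_rankK g'K enum_valK.
  apply/seteqP; split=> x /= xA i.
    have := xA (enum_rank (g' (enum_val i))).
    by rewrite tnth_mktuple enum_rankK g'K /coords enum_valK.
  rewrite tnth_mktuple /coords.
  by have := xA (enum_rank (g (enum_val i))); rewrite enum_rankK gK enum_valK.
Qed.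

(** The coordinates of the two vertex sets are independent: [h] joins two tuples, and the preimage
    of a box is a product of two boxes. *)
Lemma expect_coords_sum (S T : finType) (F : (S -> mR) -> R)
    (G : (T -> mR) -> R) :
  bounded_measurable_coords F -> bounded_measurable_coords G ->
  bounded_measurable_coords
    (fun x : (S + T)%type -> mR => F (x \o inl) * G (x \o inr)) ->
  expect_coords (fun x : (S + T)%type -> mR => F (x \o inl) * G (x \o inr)) =
  expect_coords F * expect_coords G.
Proof.
move=> bF bG bFG; rewrite /expect_coords.
pose P := (cube_measure R #|S| \x cube_measure R #|T|)%E.
pose h (z : #|S|.-tuple mR * #|T|.-tuple mR) : #|{: S + T}|.-tuple mR :=
  [tuple match enum_val i with
         | inl s => coords z.1 s | inr t => coords z.2 t end | i <
           #|{: S + T}|].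
rewrite -expect_prodM// (@expect_cube_transfer R _ _ P _ h)//.
- apply: eq_Rintegral => z _; congr (F _ * G _); apply/funext => v;
  by rewrite /= /coords tnth_mktuple enum_rankK.
- apply/measurable_fun_tnthP => i.
  pose k (z : #|S|.-tuple mR * #|T|.-tuple mR) : mR := match enum_val i with
         | inl s => coords z.1 s | inr t => coords z.2 t end.
  rewrite (_ : _ \o _ = k); last first.
    by apply/funext => x; rewrite /= tnth_mktuple.
  rewrite /k; case: (enum_val i) => v.
    exact: (measurableT_comp (measurable_tnth (enum_rank v)) measurable_fst).
  exact: (measurableT_comp (measurable_tnth (enum_rank v)) measurable_snd).
- move=> A mA.
  pose AS (j : 'I_#|S|) := A (enum_rank (inl (enum_val j) : S + T)%type).
  pose AT (j : 'I_#|T|) := A (enum_rank (inr (enum_val j) : S + T)%type).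
  rewrite (_ : _ @^-1` _ = box AS `*` box AT).
    have mAS i : measurable (AS i) by exact: mA.
    have mAT i : measurable (AT i) by exact: mA.
    apply: etrans (product_measure1E _ _ (measurable_box mAS)
      (measurable_box mAT)) _.
    rewrite [X in (X * _)%E](cube_measure_box mAS)
      [X in (_ * X)%E](cube_measure_box mAT).
    rewrite [RHS](reindex (@enum_rank {: S + T}))/=; last first.
      by exists enum_val => i _; rewrite (enum_valK, enum_rankK).
    rewrite big_sumType/=; congr (_ * _)%E.
      rewrite (reindex (@enum_rank S))/=; last first.
        by exists enum_val => i _; rewrite (enum_valK, enum_rankK).
      by apply: eq_bigr => s _; rewrite /AS enum_rankK.
    rewrite (reindex (@enum_rank T))/=; last first.
      by exists enum_val => i _; rewrite (enum_valK, enum_rankK).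
    by apply: eq_bigr => s _; rewrite /AT enum_rankK.
  apply/seteqP; split=> -[x y] /=.
    move=> xyA; split=> i.
      have := xyA (enum_rank (inl (enum_val i) : S + T)%type).
      by rewrite tnth_mktuple enum_rankK /coords enum_valK.
    have := xyA (enum_rank (inr (enum_val i) : S + T)%type).
    by rewrite tnth_mktuple enum_rankK /coords enum_valK.
  move=> [xA yA] i; rewrite tnth_mktuple.
  case: (enum_val i) (enum_valK i) => v /= <-; rewrite /coords.
    by have := xA (enum_rank v); rewrite /AS enum_rankK.
  by have := yA (enum_rank v); rewrite /AT enum_rankK.
Qed.

End coordinates.

Section density.
Context (R : realType).
Local Notation mR := (measurableTypeR R).
Local Notation I := (`[0%R, 1%R]%classic : set R).
Implicit Types U V : R -> R -> R.

(** Unlike [is_kernel], this is a condition on the whole plane, so densities become expectations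
    without restriction to the cube. *)
Definition bounded_kernel U :=
  bounded_measurable (fun p : mR * mR => U p.1 p.2).

Lemma bounded_measurable_edges (T : finType) (E : {set T * T})
    (K : T * T -> R -> R -> R) :
  (forall e, bounded_kernel (K e)) ->
  bounded_measurable_coords (fun x : T -> mR =>
    \prod_(e in E) K e (x e.1) (x e.2)).
Proof.
move=> bK; apply: bounded_measurable_prod => e.
apply: (bounded_measurable_comp (h := fun x : #|T|.-tuple mR =>
  (coords x e.1, coords x e.2)) _ (bK e)).
by apply: measurable_fun_pair; exact: measurable_tnth.
Qed.

Lemma hom_densityE (H : ograph) U : bounded_kernel U ->
  hom_density H U =
  expect_coords (fun x : H -> mR => \prod_(e in edges H) U (x e.1) (x e.2)).
Proof.
move=> bU; rewrite /hom_density [LHS]expect_unit_cube//.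
exact: (@bounded_measurable_edges H (edges H) (fun=> U)).
Qed.

Lemma eq_hom_density (H : ograph) U V :
  (forall x y, I x -> I y -> U x y = V x y) ->
  hom_density H U = hom_density H V.
Proof.
move=> UV; apply: eq_Rintegral => x /set_mem xI; apply: eq_bigr => e _.
by apply: UV; exact: xI.
Qed.

Lemma hom_density_reindex (G H : ograph) (f : G -> H) U : bounded_kernel U ->
  bijective f ->
  hom_density H U = expect_coords (fun x : G -> mR =>
    \prod_(e in [set e | (f e.1, f e.2) \in edges H]%SET) U (x e.1) (x e.2)).
Proof.
move=> bU fb; have [g fK gK] := fb.
rewrite hom_densityE// (@expect_coords_reindex _ _ _ g); last 2 first.
- by exists f.
- exact: (@bounded_measurable_edges H (edges H) (fun=> U)).
congr expect_coords; apply/funext => x.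
rewrite (reindex (fun e : G * G => (f e.1, f e.2))).
  by apply: eq_big => [e|e _]; rewrite ?inE//= !fK.
by exists (fun e => (g e.1, g e.2)) => -[u v] _ /=; rewrite ?fK ?gK.
Qed.

Lemma hom_density_iso (G H : ograph) U : bounded_kernel U ->
  ograph_iso G H -> hom_density G U = hom_density H U.
Proof.
move=> bU [f fb fE]; rewrite (hom_density_reindex bU fb) hom_densityE//.
congr expect_coords; apply/funext => x; apply: eq_bigl => -[u v].
by rewrite inE fE.
Qed.

Lemma hom_density_dunion (G H : ograph) U : bounded_kernel U ->
  hom_density (dunion G H) U = hom_density G U * hom_density H U.
Proof.
move=> bU; have bE (K : ograph) :=
  @bounded_measurable_edges K (edges K) (fun=> U) (fun=> bU).
pose FG (x : G -> mR) := \prod_(e in edges G) U (x e.1) (x e.2).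
pose FH (x : H -> mR) := \prod_(e in edges H) U (x e.1) (x e.2).
have prodE (x : (G + H)%type -> mR) :
    \prod_(e in edges (dunion G H)) U (x e.1) (x e.2) =
    FG (x \o inl) * FH (x \o inr).
  pose EG : {set (G + H) * (G + H)} :=
    [set (inl e.1, inl e.2) | e in edges G]%SET.
  pose EH : {set (G + H) * (G + H)} :=
    [set (inr e.1, inr e.2) | e in edges H]%SET.
  have EGP e : e \in EG =
    if e is (inl u, inl v) then (u, v) \in edges G else false.
    apply/imsetP/idP => [[[u v] uv ->]//|].
    by case: e => -[u|u] [v|v]// uv; exists (u, v).
  have EHP e : e \in EH =
    if e is (inr u, inr v) then (u, v) \in edges H else false.
    apply/imsetP/idP => [[[u v] uv ->]//|].
    by case: e => -[u|u] [v|v]// uv; exists (u, v).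
  rewrite (bigID (mem EG))/=; congr (_ * _).
    rewrite (eq_bigl (mem EG)); last first.
      by move=> [[u|u] [v|v]]; rewrite /= !inE EGP ?andbF//= andbb.
    rewrite big_imset/=; first by apply: eq_bigr.
    by move=> [u v] [u' v'] _ _ [-> ->].
  rewrite (eq_bigl (mem EH)); last first.
    move=> [[u|u] [v|v]]; rewrite /= !inE EGP EHP ?andbT//=.
    by rewrite andbN.
  rewrite big_imset/=; first by apply: eq_bigr.
  by move=> [u v] [u' v'] _ _ [-> ->].
rewrite !hom_densityE// -expect_coords_sum//.
- by congr expect_coords; apply/funext => x; rewrite prodE.
- have := bE (dunion G H); congr bounded_measurable.
  by apply/funext => x; rewrite prodE.
Qed.

Lemma hom_density_edgeless m U : bounded_kernel U ->
  hom_density (edgeless m) U = 1.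
Proof.
move=> bU; rewrite hom_densityE// /expect_coords.
by under eq_Rintegral do rewrite big_set0; rewrite expect_cst.
Qed.

(** The edges of the reversed graph that are not edges of [G] are exactly the flipped ones, and each
    of them contributes one factor -1. *)
Lemma hom_density_reverse (G : ograph) (S : {set G * G}) U :
  bounded_kernel U -> (forall x y, U x y = - U y x) -> S \subset edges G ->
  hom_density (reverse S) U = (-1) ^+ #|S| * hom_density G U.
Proof.
move=> bU antiU SE; rewrite !hom_densityE// /expect_coords.
rewrite -expectZl; last
  exact: (@bounded_measurable_edges G (edges G) (fun=> U)).
apply: eq_Rintegral => x _; move: (coords x) => {}x.
pose sw (e : G * G) := (e.2, e.1).
have swE e : e \in S -> sw e \notin edges G.
  by case: e => u v uv; rewrite (edges_oriented (fintype.subsetP SE _ uv)).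
rewrite (bigID (mem (edges G)))/= mulrC [in RHS](bigID (mem S))/= mulrA.
congr (_ * _); last first.
  apply: eq_bigl => -[u v]; rewrite !inE /=.
  case uvE: ((u, v) \in edges G); rewrite ?andbF //= ?andbT.
  by rewrite (negbTE (edges_oriented uvE)) ?orbF.
rewrite (eq_bigl (mem (sw @: S))); last first.
  move=> [u v]; rewrite !inE /=; apply/andP/imsetP => /=.
    by case=> + uv; rewrite (negbTE uv) => /andP[_ vu]; exists (v, u).
  case=> -[a b] abS [-> ->]; have := swE _ abS; rewrite /sw/= => ->.
  by rewrite abS (fintype.subsetP SE _ abS) orbT.
rewrite big_imset/=; last by move=> [a b] [c d] _ _ [-> ->].
rewrite [in RHS](eq_bigl (mem S)); last first.
  by move=> e; rewrite /= andbC;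
    case: (boolP (e \in S)) => //= /(fintype.subsetP SE).
rewrite -prodrN; apply: eq_bigr => e _; exact: antiU.
Qed.

Lemma hom_density_obtained (b : bool) (G H : ograph) U :
  bounded_kernel U -> (forall x y, U x y = - U y x) ->
  obtained_by_reversing b G H -> hom_density H U = (-1) ^+ b * hom_density G U.
Proof.
move=> bU antiU [S [SE <- /(hom_density_iso bU) <-]].
by rewrite hom_density_reverse// signr_odd.
Qed.

Lemma prodrD_sum (T : finType) (E : {set T}) (a b : T -> R) :
  \prod_(e in E) (a e + b e) =
  \sum_(F : {set T} | F \subset E)
    (\prod_(e in F) a e) * \prod_(e in E :\: F) b e.
Proof.
(* Outside [E], the value 0 of [a'] discards every [F] not contained in [E], and the value 1 of [b']
   is neutral. *)
pose a' e := if e \in E then a e else 0.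
pose b' e := if e \in E then b e else 1.
have -> : \prod_(e in E) (a e + b e) = \prod_e (a' e + b' e).
  rewrite big_mkcond/=; apply: eq_bigr => e _.
  by rewrite /a' /b'; case: ifP => // _; rewrite add0r.
rewrite bigA_distr [RHS]big_mkcond/=; apply: eq_bigr => F _.
case: ifPn => [FE|/subsetPn[e eF eE]]; last first.
  by rewrite (bigD1 e)//= eF /a' (negbTE eE) mul0r.
rewrite (bigID (mem F))/=; congr (_ * _).
  apply: eq_bigr => e eF.
  by rewrite eF /a' (fintype.subsetP FE).
rewrite [RHS]big_mkcond/= [LHS]big_mkcond/=; apply: eq_bigr => e _.
by rewrite inE /b'; case: (e \in F).
Qed.

Lemma hom_densityD (H : ograph) U V : bounded_kernel U -> bounded_kernel V ->
  hom_density H (fun x y => U x y + V x y) =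
  \sum_(F : {set H * H} | F \subset edges H)
    expect_coords (fun x : H -> mR => \prod_(e in edges H)
      (if e \in F then U else V) (x e.1) (x e.2)).
Proof.
move=> bU bV; rewrite hom_densityE; last exact: bounded_measurableD.
rewrite /expect_coords -expect_sum; last first.
  move=> F; apply: (@bounded_measurable_edges H _
    (fun e => if e \in F then U else V)).
  by move=> e; case: ifP.
apply: eq_Rintegral => x _; rewrite prodrD_sum; apply: eq_bigr => F FE.
rewrite [RHS](bigID (mem F))/=; congr (_ * _).
  rewrite [RHS](eq_bigl (mem F)); last first.
    by move=> e /=; rewrite andbC;
      case: (boolP (e \in F)) => //= /(fintype.subsetP FE).
  by apply: eq_bigr => e ->.
rewrite [RHS](eq_bigl (mem (edges H :\: F))); last first.
  by move=> e; rewrite !inE andbC.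
by apply: eq_bigr => e; rewrite !inE => /andP[/negbTE ->].
Qed.

Lemma hom_density_half (H : ograph) U : bounded_kernel U ->
  hom_density H (fun x y => 1 / 2 + U x y) =
  \sum_(F : {set H * H} | F \subset edges H)
    hom_density (spanning F) U / 2 ^+ (#|edges H| - #|F|).
Proof.
move=> bU.
rewrite (_ : (fun _ => _) = fun x y => U x y + 1 / 2); last first.
  by apply/funext => x; apply/funext => y; rewrite addrC.
rewrite (hom_densityD H bU (bounded_measurable_cst _ (1 / 2))).
apply: eq_bigr => F FE;
  rewrite hom_densityE// /expect_coords [RHS]mulrC -expectZl; last first.
  exact: (@bounded_measurable_edges (spanning F) (edges (spanning F))
    (fun=> U)).
apply: eq_Rintegral => x _; rewrite (bigID (mem F))/= mulrC; congr (_ * _).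
  rewrite (eq_bigl (mem (edges H :\: F))); last by move=> e; rewrite !inE andbC.
  rewrite (eq_bigr (fun=> 2^-1)); last first.
    by move=> e; rewrite !inE => /andP[/negbTE -> _]; rewrite div1r.
  rewrite prodr_const cardsD exprVn; congr (_ ^- (_ - #|pred_of_set _|)).
  exact/finset.setIidPr.
rewrite (eq_bigl (mem (spanning_edges F))); last by move=> e; rewrite !inE.
by apply: eq_bigr => e; rewrite !inE => /andP[_ ->].
Qed.

(** With [A = W + U] and [D = V - U] the kernel is [A + s * D], and an edge set [F] contributes to
    degree [#|F|]. The intermediate value theorem is then needed for polynomials only. *)
Lemma hom_densityZD_poly (H : ograph) U V W :
  bounded_kernel U -> bounded_kernel V -> bounded_kernel W ->
  exists p : {poly R}, forall s : R,
    hom_density H (fun x y => W x y + ((1 - s) * U x y + s * V x y)) = p.[s].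
Proof.
move=> bU bV bW.
pose D x y := V x y - U x y.
pose A x y := W x y + U x y.
have bA : bounded_kernel A by exact: bounded_measurableD.
have bD : bounded_kernel D.
  rewrite /D /bounded_kernel; under eq_fun do rewrite -mulN1r.
  by apply: bounded_measurableD => //; exact: bounded_measurableZ.
exists (\sum_(F : {set H * H} | F \subset edges H)
  (expect_coords (fun x : H -> mR => \prod_(e in edges H)
      (if e \in F then D else A) (x e.1) (x e.2)) *: 'X^#|F|)) => s.
rewrite (_ : (fun _ => _) = fun x y => s * D x y + A x y); last first.
  by apply/funext => x; apply/funext => y; rewrite /D /A; ring.
have bsD : bounded_kernel (fun x y => s * D x y) by exact: bounded_measurableZ.
rewrite hom_densityD// horner_sum; apply: eq_bigr => F FE.
rewrite hornerZ hornerXn /expect_coords [RHS]mulrC -expectZl; last first.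
  apply: (@bounded_measurable_edges H _ (fun e => if e \in F then D else A)).
  by move=> e; case: ifP.
apply: eq_Rintegral => x _;
  rewrite (bigID (mem F)) [in RHS](bigID (mem F))/= mulrA.
congr (_ * _); last by apply: eq_bigr => e /andP[_ /negbTE ->].
rewrite -[#|F|](_ : #|[set e in edges H | e \in F]%SET| = _); last first.
  by apply: eq_card => e; rewrite inE andbC;
    case: (boolP (e \in F)) => //= /(fintype.subsetP FE).
rewrite -prodr_const big_mkcond/=
  [\prod_(i in [set _ in _ | _]%SET) _]big_mkcond/=.
rewrite [X in _ = _ * X]big_mkcond/= -big_split/=; apply: eq_bigr => e _.
by rewrite inE; case: (e \in edges H); case: (e \in F); rewrite /= ?mulr1.
Qed.

End density.

(** * Walks and the integral operator of a kernel *)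

Section walks.
Context (R : realType).
Local Notation mR := (measurableTypeR R).
Local Notation la := (@lebesgue01 R).
Implicit Types (U : R -> R -> R) (g k : R -> R).

(** The cardinal [#|'I_m|] is not convertible to [m], so the two tuple types are linked by a change
    of variables. *)
Lemma expect_coords_ord m (F : ('I_m -> mR) -> R) :
  bounded_measurable_coords F ->
  expect_coords F = \int[cube_measure R m]_x F (tnth x).
Proof.
move=> bF; rewrite /expect_coords.
pose h (x : m.-tuple mR) : #|'I_m|.-tuple mR :=
  [tuple tnth x (enum_val i) | i < #|'I_m|].
rewrite (@expect_cube_transfer R _ _ (cube_measure R m) #|'I_m| h)//.
- apply: eq_Rintegral => x _; congr F; apply/funext => v.
  by rewrite /coords tnth_mktuple enum_rankK.
- apply/measurable_fun_tnthP => i.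
  rewrite (_ : _ \o _ = fun x => tnth x (enum_val i)); last first.
    by apply/funext => x; rewrite /= tnth_mktuple.
  exact: measurable_tnth.
- move=> A mA.
  rewrite (_ : _ @^-1` _ = box (fun j => A (enum_rank j))).
    rewrite [LHS]cube_measure_box//.
    rewrite [RHS](reindex (@enum_rank 'I_m))//=.
    by exists enum_val => i _; rewrite (enum_valK, enum_rankK).
  apply/seteqP; split=> x /= xA i.
    by have := xA (enum_rank i); rewrite tnth_mktuple enum_rankK.
  by rewrite tnth_mktuple; have := xA (enum_val i); rewrite enum_valK.
Qed.

Lemma expect_cube_cons m (f : m.+1.-tuple mR -> R) : bounded_measurable f ->
  \int[cube_measure R m.+1]_x f x =
  \int[la]_y \int[cube_measure R m]_x f (tuple_cons (y, x)).
Proof.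
move=> bf; rewrite [LHS]expect_distribution// expect_prod//.
exact: (bounded_measurable_comp (@measurable_tuple_cons R m)).
Qed.

Lemma bounded_kernel_section U x : bounded_kernel U -> bounded_measurable (U x).
Proof. exact: (@bounded_measurable_section _ _ mR mR R _ x). Qed.

Definition kernel_op U g (x : R) : R := \int[la]_y (U x y * g y).

(** A path with a weight at each end. Weights 1 give the density of [dipath]; weights taken from a
    closing edge give that of a cycle. *)
Definition walk m U k g (x : m.+1.-tuple mR) : R :=
  k (tnth x ord0) *
  (\prod_(i < m) U (tnth x (widen_ord (leqnSn m) i)) (tnth x (lift ord0 i))) *
  g (tnth x ord_max).

Lemma bounded_measurable_walk m U k g : bounded_kernel U ->
  bounded_measurable (k : mR -> R) -> bounded_measurable (g : mR -> R) ->
  bounded_measurable (@walk m U k g).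
Proof.
move=> bU bk bg; apply: bounded_measurableM; first apply: bounded_measurableM.
- exact: (bounded_measurable_comp (measurable_tnth ord0) bk).
- apply: bounded_measurable_prod => i.
  apply: (bounded_measurable_comp (h := fun x : m.+1.-tuple mR =>
    (tnth x (widen_ord (leqnSn m) i), tnth x (lift ord0 i))) _ bU).
  by apply: measurable_fun_pair; exact: measurable_tnth.
- exact: (bounded_measurable_comp (measurable_tnth ord_max) bg).
Qed.

Lemma expect_walk m U k g : bounded_kernel U ->
  bounded_measurable (k : mR -> R) -> bounded_measurable (g : mR -> R) ->
  \int[cube_measure R m.+1]_x walk U k g x =
  \int[la]_y (k y * iter m (kernel_op U) g y).
Proof.
(* The initial weight [k] is generalised: once the first vertex is fixed at [y], the section [U y]
   is the initial weight of the remaining walk. *)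
move=> bU + bg; elim: m k => [|m IH] k bk.
  rewrite expect_cube_cons; last exact: bounded_measurable_walk.
  apply: eq_Rintegral => y _; rewrite -[RHS](expect_cst (cube_measure R 0)).
  apply: eq_Rintegral => x _; rewrite /walk big_ord0 mulr1.
  by rewrite [ord_max](_ : _ = ord0)//; exact: val_inj.
rewrite expect_cube_cons; last exact: bounded_measurable_walk.
apply: eq_Rintegral => y _; rewrite iterS /kernel_op -IH; last first.
  exact: bounded_kernel_section.
rewrite -expectZl; last first.
  by apply: bounded_measurable_walk => //; exact: bounded_kernel_section.
apply: eq_Rintegral => x _; rewrite /walk big_ord_recl !mulrA.
have t0 : tnth (tuple_cons (y, x)) ord0 = y by [].
have tS i : tnth (tuple_cons (y, x)) (lift ord0 i) = tnth x i by exact: tnthS.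
rewrite (_ : widen_ord _ ord0 = ord0); last exact: val_inj.
rewrite (_ : ord_max = lift ord0 ord_max); last exact: val_inj.
rewrite t0 !tS; congr (_ * _ * _); apply: eq_bigr => i _.
rewrite (_ : widen_ord _ (lift ord0 i) = lift ord0 (widen_ord (leqnSn m) i))
  ?tS//.
exact: val_inj.
Qed.

Lemma prod_dipath m U (x : 'I_m.+1 -> mR) :
  \prod_(e in edges (dipath m)) U (x e.1) (x e.2) =
  \prod_(i < m) U (x (widen_ord (leqnSn m) i)) (x (lift ord0 i)).
Proof.
rewrite edges_dipathE big_imset/=; last first.
  by move=> i j _ _; exact: dipath_edge_inj.
by apply: eq_bigl => i; rewrite inE.
Qed.

Lemma hom_density_dipath m U : bounded_kernel U ->
  hom_density (dipath m) U = \int[la]_y (iter m (kernel_op U) (fun=> 1) y).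
Proof.
move=> bU; rewrite hom_densityE// expect_coords_ord; last first.
  exact: (@bounded_measurable_edges R (dipath m) (edges (dipath m)) (fun=> U)).
transitivity (\int[cube_measure R m.+1]_x walk U (fun=> 1) (fun=> 1) x).
  by apply: eq_Rintegral => x _; rewrite prod_dipath /walk mul1r mulr1.
rewrite expect_walk//; try exact: bounded_measurable_cst.
by apply: eq_Rintegral => y _; rewrite mul1r.
Qed.

End walks.

(** * The edges of D_l in cyclic order *)

Section Dcycle_edges.
Context (n : nat).
Local Notation l := (n.+2.*2).

(** The edge between the cyclic positions [i] and [i + 1]: it points forward on the first side of
    the cycle and backward on the second. *)
Definition Dcycle_edge (i : 'I_l) : 'I_l * 'I_l :=
  if (i < n.+2)%N then (i, ordS i) else (ordS i, i).

Lemma ordSE (i : 'I_l) : ordS i = (if i.+1 == l then 0 else i.+1)%N :> nat.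
Proof.
rewrite /=; have := ltn_ord i; case: eqP => [->|] *; first by rewrite modnn.
by rewrite modn_small; lia.
Qed.

Lemma Dcycle_edge_inj : injective Dcycle_edge.
Proof.
have ll : (n.+2 + n.+2 = l)%N by rewrite addnn.
move=> i j; rewrite /Dcycle_edge; have := ltn_ord i; have := ltn_ord j.
have := ordSE i; have := ordSE j.
have pI (a b c d : 'I_l) : (a, b) = (c, d) -> a = c /\ b = d by case.
case: (ltnP i n.+2) => i2; case: (ltnP j n.+2) => j2 ej ei jl il /pI[e1 e2] //.
- move: ei ej; rewrite e2 -e1; have := congr1 val e1; have := congr1 val e2.
  by move=> /= h1 h2; do 2 case: eqP; lia.
- move: ei ej; rewrite e1 -e2; have := congr1 val e1; have := congr1 val e2.
  by move=> /= h1 h2; do 2 case: eqP; lia.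
Qed.

Lemma edges_DcycleE :
  edges (Dcycle n.+2) = (Dcycle_edge @: [set: 'I_l])%SET.
Proof.
apply/finset.setP => -[u v]; rewrite !inE.
have ll : (n.+2 + n.+2 = l)%N by rewrite addnn.
have := ltn_ord u; have := ltn_ord v; move=> vl ul.
apply/idP/imsetP => [/= /or3P[]/andP[uv vu]|[i _]].
- exists u; rewrite ?inE// /Dcycle_edge uv; congr pair; apply: ord_inj.
  by rewrite ordSE; case: eqP; lia.
- exists v; rewrite ?inE// /Dcycle_edge ifF; last lia.
  by congr pair; apply: ord_inj; rewrite ordSE; case: eqP; lia.
- exists v; rewrite ?inE// /Dcycle_edge ifF; last lia.
  by congr pair; apply: ord_inj; rewrite ordSE; case: eqP; lia.
have := ordSE i; have := ltn_ord i; rewrite /Dcycle_edge => il iS ->.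
move: iS; case: (i.+1 =P l) => e iS;
  by case: ifP => i2; rewrite [(_, _).1]/= [(_, _).2]/= iS; lia.
Qed.

Lemma card_edges_Dcycle : #|edges (Dcycle n.+2)| = l.
Proof. by rewrite edges_DcycleE (card_imset _ Dcycle_edge_inj) cardsT card_ord.
  Qed.

(** The [n.+2] edges of the second side are traversed backwards, which costs the sign
    [(-1)^(n+2) = (-1)^n]. *)
Lemma prod_Dcycle (R : realType) (U : R -> R -> R) (x : 'I_l -> R) :
  (forall x y, U x y = - U y x) ->
  \prod_(e in edges (Dcycle n.+2)) U (x e.1) (x e.2) =
  (-1) ^+ n * \prod_(i < l) U (x i) (x (ordS i)).
Proof.
move=> antiU; rewrite edges_DcycleE big_imset/=; last first.
  by move=> i j _ _; exact: Dcycle_edge_inj.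
rewrite (eq_bigl xpredT); last by move=> i; rewrite inE.
rewrite (eq_bigr (fun i : 'I_l => (if (i < n.+2)%N then 1 else -1) *
  U (x i) (x (ordS i)))).
  rewrite big_split/=; congr (_ * _).
  rewrite -addnn big_split_ord/= big1 ?mul1r.
    rewrite (eq_bigr (fun=> -1)) ?prodr_const ?card_ord.
      by rewrite -signr_odd /= negbK signr_odd.
    by move=> i _; rewrite ifF//; lia.
  by move=> i _; rewrite ltn_ord.
move=> i _; rewrite /Dcycle_edge; case: ifP => _ /=; first by rewrite mul1r.
by rewrite antiU mulN1r.
Qed.

End Dcycle_edges.

(** * A regular kernel of rank two *)

Section rank_two_kernel.
Context (R : realType).
Local Notation mR := (measurableTypeR R).
Local Notation la := (@lebesgue01 R).
Context (a b : R -> R) (c r : R).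
Hypotheses (ba : bounded_measurable (a : mR -> R))
           (bb : bounded_measurable (b : mR -> R)).
Hypotheses (ia : \int[la]_y a y = 0) (ib : \int[la]_y b y = 0)
  (iab : \int[la]_y (a y * b y) = 0)
  (iaa : \int[la]_y (a y * a y) = r) (ibb : \int[la]_y (b y * b y) = r).

(* The associated operator maps [a] to [- c r b], [b] to [c r a] and [1] to
   [0], so its iterates are explicit. *)
Definition rank_two (x y : R) : R := c * (a x * b y - b x * a y).
Local Notation T := (kernel_op rank_two).

Lemma rank_two_anti x y : rank_two x y = - rank_two y x.
Proof. by rewrite /rank_two; ring. Qed.

Lemma bounded_rank_two : bounded_kernel rank_two.
Proof.
have bfst f : bounded_measurable (f : mR -> R) ->
    bounded_measurable (fun p : mR * mR => f p.1).
  exact: (bounded_measurable_comp (h := fst)).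
have bsnd f : bounded_measurable (f : mR -> R) ->
    bounded_measurable (fun p : mR * mR => f p.2).
  exact: (bounded_measurable_comp (h := snd)).
apply: bounded_measurableZ; apply: bounded_measurableD.
  by apply: bounded_measurableM; [exact: bfst|exact: bsnd].
under eq_fun do rewrite -mulN1r; apply: bounded_measurableZ.
by apply: bounded_measurableM; [exact: bfst|exact: bsnd].
Qed.

Lemma rank_two_op g : bounded_measurable (g : mR -> R) ->
  T g = fun x => c * (a x * \int[la]_y (b y * g y) - b x * \int[la]_y
    (a y * g y)).
Proof.
move=> bg; apply/funext => x.
have bag : bounded_measurable (fun y : mR => a y * g y)
  by exact: bounded_measurableM.
have bbg : bounded_measurable (fun y : mR => b y * g y)
  by exact: bounded_measurableM.
transitivity (\int[la]_y ((c * a x) * (b y * g y) + (- c * b x) * (a y * g y))).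
  by apply: eq_Rintegral => y _; rewrite /rank_two; ring.
rewrite expectD; try exact: bounded_measurableZ.
by rewrite !expectZl//; ring.
Qed.

Lemma rank_two_op_a q : T (fun y => q * a y) = fun x => - (c * r) * q * b x.
Proof.
rewrite rank_two_op; last exact: bounded_measurableZ.
apply/funext => x.
rewrite (_ : \int[la]_y (b y * (q * a y)) = q * \int[la]_y (a y * b y)).
  rewrite (_ : \int[la]_y (a y * (q * a y)) = q * \int[la]_y (a y * a y)).
    by rewrite iab iaa; ring.
  by rewrite -expectZl; [apply: eq_Rintegral => y _;
    ring|exact: bounded_measurableM].
by rewrite -expectZl; [apply: eq_Rintegral => y _;
  ring|exact: bounded_measurableM].
Qed.

Lemma rank_two_op_b q : T (fun y => q * b y) = fun x => (c * r) * q * a x.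
Proof.
rewrite rank_two_op; last exact: bounded_measurableZ.
apply/funext => x.
rewrite (_ : \int[la]_y (b y * (q * b y)) = q * \int[la]_y (b y * b y)).
  rewrite (_ : \int[la]_y (a y * (q * b y)) = q * \int[la]_y (a y * b y)).
    by rewrite iab ibb; ring.
  by rewrite -expectZl; [apply: eq_Rintegral => y _;
    ring|exact: bounded_measurableM].
by rewrite -expectZl; [apply: eq_Rintegral => y _;
  ring|exact: bounded_measurableM].
Qed.

(** The square of the operator is multiplication by [-(c r)^2] on the span of [a] and [b]. Odd
    iterates are the relevant ones: an even cycle without its closing edge has an odd number of
    edges. *)
Lemma iter_rank_two_a j :
  iter j.*2.+1 T a = fun x => - (c * r) * (- (c * r) ^+ 2) ^+ j * b x.
Proof.
elim: j => [|j IH].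
  have := rank_two_op_a 1; rewrite (_ : (fun y => 1 * a y) = a) /= => [->|].
    by apply/funext => x; rewrite expr0.
  by apply/funext => x; rewrite mul1r.
rewrite doubleS iterS [iter _ _ _]iterS IH rank_two_op_b rank_two_op_a.
by apply/funext => x; rewrite [_ ^+ j.+1]exprS; move: (_ ^+ j) => Q; ring.
Qed.

Lemma iter_rank_two_b j :
  iter j.*2.+1 T b = fun x => (c * r) * (- (c * r) ^+ 2) ^+ j * a x.
Proof.
elim: j => [|j IH].
  have := rank_two_op_b 1; rewrite (_ : (fun y => 1 * b y) = b) /= => [->|].
    by apply/funext => x; rewrite expr0.
  by apply/funext => x; rewrite mul1r.
rewrite doubleS iterS [iter _ _ _]iterS IH rank_two_op_a rank_two_op_b.
by apply/funext => x; rewrite [_ ^+ j.+1]exprS; move: (_ ^+ j) => Q; ring.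
Qed.

(** Since [a] and [b] have mean 0, the operator sends 1 to 0, and so do all its positive
    iterates. *)
Lemma hom_density_dipath_rank_two m : (0 < m)%N ->
  hom_density (dipath m) rank_two = 0.
Proof.
case: m => // m _; rewrite hom_density_dipath; last exact: bounded_rank_two.
have T1 : T (fun=> 1) = fun=> 0.
  rewrite rank_two_op; last exact: bounded_measurable_cst.
  apply/funext => x; under eq_Rintegral do rewrite mulr1.
  by under [X in _ - _ * X]eq_Rintegral do rewrite mulr1; rewrite ia ib; ring.
have T0 : T (fun=> 0) = fun=> 0.
  rewrite rank_two_op; last exact: bounded_measurable_cst.
  apply/funext => x; under eq_Rintegral do rewrite mulr0.
  under [X in _ - _ * X]eq_Rintegral do rewrite mulr0.
  by rewrite !expect_cst; ring.
have -> : iter m.+1 T (fun=> 1) = fun=> 0.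
  by rewrite iterSr T1; elim: m => //= m ->.
by rewrite expect_cst.
Qed.

Lemma hom_density_Qpath_rank_two n : (0 < n)%N ->
  hom_density (Qpath n) rank_two = 0.
Proof.
move=> n0; have [s Qs] := adj_iso_obtained (Qpath_dipath n).
have := hom_density_obtained bounded_rank_two rank_two_anti Qs.
rewrite hom_density_dipath_rank_two ?double_gt0// => /esym/eqP.
by rewrite mulf_eq0 signr_eq0 => /eqP.
Qed.

(** The closing edge is a combination of two products, each of a function of the last vertex and one
    of the first. The cyclic product is thus a sum of two weighted walks, and its integral is the
    trace of a power of the operator. *)
Lemma hom_density_Dcycle_rank_two n :
  hom_density (Dcycle n.+2) rank_two = 2 * ((c * r) ^+ 2) ^+ n.+2.
Proof.
have bU := bounded_rank_two.
rewrite hom_densityE// expect_coords_ord; last first.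
  exact: (@bounded_measurable_edges R (Dcycle n.+2) (edges (Dcycle n.+2))
    (fun=> rank_two)).
(* This is [l - 1], the number of edges besides the closing one. *)
pose m := n.+1.*2.+1.
transitivity ((-1) ^+ n * (\int[cube_measure R m.+1]_x
  (walk rank_two (fun y => c * b y) a x + walk rank_two (fun y => - c * a y) b
    x))).
  rewrite -expectZl; last first.
    by apply: bounded_measurableD; apply: bounded_measurable_walk => //;
      exact: bounded_measurableZ.
  apply: eq_Rintegral => x _; rewrite prod_Dcycle; last exact: rank_two_anti.
  congr (_ * _); rewrite [LHS](@big_ord_recr _ _ _ m)/= /walk.
  rewrite (_ : rank_two _ _ = c * (a (tnth x ord_max) * b (tnth x ord0) -
    b (tnth x ord_max) * a (tnth x ord0))); last first.
    congr (c * (_ * b (tnth x _) - _ * a (tnth x _)));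
    by apply: ord_inj; rewrite /= modnn.
  rewrite (eq_bigr (fun i : 'I_m =>
    rank_two (tnth x (widen_ord (leqnSn m) i)) (tnth x (lift ord0 i))));
      last first.
    move=> i _; congr (rank_two (tnth x _) (tnth x _)).
    by apply: ord_inj; rewrite /= modn_small// /bump/=; have := ltn_ord i.
  by ring.
rewrite expectD; try by apply: bounded_measurable_walk => //;
  exact: bounded_measurableZ.
rewrite !expect_walk//; try exact: bounded_measurableZ.
rewrite /m iter_rank_two_a iter_rank_two_b.
set q := c * r; set Q := (- q ^+ 2) ^+ n.+1.
have -> : \int[la]_y (c * b y * (- q * Q * b y)) = - (c * q * Q) * r.
  rewrite -ibb -expectZl; last exact: bounded_measurableM.
  by apply: eq_Rintegral => y _; ring.
have -> : \int[la]_y (- c * a y * (q * Q * a y)) = - (c * q * Q) * r.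
  rewrite -iaa -expectZl; last exact: bounded_measurableM.
  by apply: eq_Rintegral => y _; ring.
rewrite (_ : - _ * _ + _ = 2 * (- q ^+ 2) ^+ n.+2); last first.
  by rewrite [_ ^+ n.+2]exprS -/Q; clearbody Q; rewrite /q; ring.
(* The sign [(-1)^(n+2)] of the iterates cancels the [(-1)^n] of [prod_Dcycle]. *)
rewrite mulrCA -[- q ^+ 2]mulN1r exprMn; congr (_ * _).
by rewrite mulrA -exprD -signr_odd !addnS /= addnn negbK odd_double mul1r.
Qed.

End rank_two_kernel.

(** * Step functions that realise the rank two kernel *)

Section quarters.
Context (R : realType).
Local Notation mR := (measurableTypeR R).
Local Notation la := (@lebesgue01 R).

Definition quarter (j : nat) : set mR := `[j%:R / 4, j.+1%:R / 4[.

Lemma measurable_quarter j : measurable (quarter j).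
Proof. exact: measurable_itv. Qed.

Lemma quarter_inj i j x : quarter i x -> quarter j x -> i = j.
Proof.
rewrite /quarter /= !in_itv /= => /andP[ix xi] /andP[jx xj].
have h (m n : nat) : m%:R / 4 <= x -> x < n.+1%:R / 4 -> (m <= n)%N.
  move=> mx xn; have := le_lt_trans mx xn.
  by rewrite ltr_pM2r ?invr_gt0// ltr_nat ltnS.
by apply/eqP; rewrite eqn_leq !h.
Qed.

Definition indq (j : nat) : R -> R := \1_(quarter j).

Lemma bounded_indq j : bounded_measurable (indq j : mR -> R).
Proof.
split; first by apply: measurable_indic; exact: measurable_quarter.
by exists 1 => x; rewrite /indq indicE; case: (_ \in _);
  rewrite ?normr1 ?normr0.
Qed.

Lemma indq_mul i j x : indq i x * indq j x = (i == j)%:R * indq i x.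
Proof.
rewrite /indq !indicE; case: (boolP (x \in quarter i)) => [/set_mem xi|];
  last first.
  by rewrite mul0r mulr0.
rewrite mul1r mulr1; case: (boolP (x \in quarter j)) => [/set_mem xj|xj].
  by rewrite (quarter_inj xi xj) eqxx.
by case: eqP xj => // <-; rewrite mem_set.
Qed.

Lemma expect_indq j : (j < 4)%N -> \int[la]_x indq j x = 1 / 4.
Proof.
move=> j4; rewrite /Rintegral integral_indic//; last exact: measurable_quarter.
have I01 : quarter j `&` `[0, 1] = quarter j.
  apply/setIidPl => x; rewrite /quarter /= !in_itv /= => /andP[jx xj].
  rewrite (le_trans _ jx) ?divr_ge0//= (le_trans (ltW xj))//.
  by rewrite ler_pdivrMr// mul1r ler_nat.
rewrite setIT; transitivity (fine (lebesgue_measure (quarter j))).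
  by rewrite -[in RHS]I01.
rewrite lebesgue_measure_itv /= lte_fin ltr_pM2r ?invr_gt0// ltr_nat ltnSn.
by rewrite -EFinB /= -mulrBl -natrB// subSnn.
Qed.

(** Values 1 and -1 on equal lengths give mean 0 to [qa] and [qb], and disjoint supports make them
    orthogonal. Two quarters of length 1/4 give the squared norm [r = 1/2]. *)
Definition qa x : R := indq 0 x - indq 1 x.
Definition qb x : R := indq 2 x - indq 3 x.

Definition regular_kernel (c : R) := rank_two qa qb c.

Lemma bounded_indqB i j : bounded_measurable
  (fun x : mR => indq i x - indq j x).
Proof.
apply: bounded_measurableD; first exact: bounded_indq.
under eq_fun do rewrite -mulN1r; apply: bounded_measurableZ;
  exact: bounded_indq.
Qed.

Lemma expect_indq_lin (i j : nat) (u v : R) : (i < 4)%N -> (j < 4)%N ->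
  \int[la]_x (u * indq i x + v * indq j x) = (u + v) / 4.
Proof.
move=> i4 j4; rewrite expectD; try by apply: bounded_measurableZ;
  exact: bounded_indq.
rewrite !expectZl; try exact: bounded_indq.
by rewrite !expect_indq//; ring.
Qed.

Lemma qaE : \int[la]_y qa y = 0.
Proof.
rewrite -[RHS](_ : (1 + -1) / 4 = 0); last by ring.
rewrite -(@expect_indq_lin 0 1)//; apply: eq_Rintegral => x _; rewrite /qa;
  ring.
Qed.

Lemma qbE : \int[la]_y qb y = 0.
Proof.
rewrite -[RHS](_ : (1 + -1) / 4 = 0); last by ring.
rewrite -(@expect_indq_lin 2 3)//; apply: eq_Rintegral => x _; rewrite /qb;
  ring.
Qed.

Lemma qabE x : qa x * qb x = 0.
Proof.
by rewrite /qa /qb mulrBl !mulrBr !indq_mul/=; ring.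
Qed.

Lemma qaaE : \int[la]_y (qa y * qa y) = 1 / 2.
Proof.
rewrite (_ : 1 / 2 = (1 + 1) / 4); last by field.
rewrite -(@expect_indq_lin 0 1)//; apply: eq_Rintegral => x _.
by rewrite /qa mulrBl !mulrBr !indq_mul/=; ring.
Qed.

Lemma qbbE : \int[la]_y (qb y * qb y) = 1 / 2.
Proof.
rewrite (_ : 1 / 2 = (1 + 1) / 4); last by field.
rewrite -(@expect_indq_lin 2 3)//; apply: eq_Rintegral => x _.
by rewrite /qb mulrBl !mulrBr !indq_mul/=; ring.
Qed.

Lemma regular_kernelN c x y : regular_kernel (- c) x y = - regular_kernel c x y.
Proof. by rewrite /regular_kernel /rank_two mulNr. Qed.

Lemma bounded_regular_kernel c : bounded_kernel (regular_kernel c).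
Proof. apply: bounded_rank_two; exact: bounded_indqB. Qed.

(** Both products in the kernel are at most 1 in absolute value, whence the bound [2 |c|] and the
    threshold 1/4 for [c]. *)
Lemma regular_kernel_le c x y : `|c| <= 1 / 4 -> `|regular_kernel c x y| <=
  1 / 2.
Proof.
have ind01 j z : indq j z = 0 \/ indq j z = 1.
  by rewrite /indq indicE; case: (_ \in _); [right|left].
have le1 i j z : `|indq i z - indq j z| <= 1.
  by case: (ind01 i z) => ->; case: (ind01 j z) => ->;
    rewrite ?subrr ?subr0 ?sub0r ?normrN ?normr0 ?normr1.
have M1 (u v : R) : `|u| <= 1 -> `|v| <= 1 -> `|u * v| <= 1.
  by move=> u1 v1; rewrite normrM mulr_ile1.
move=> c4; rewrite /regular_kernel /rank_two normrM.
rewrite [leRHS](_ : _ = 1 / 4 * 2); last by field.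
apply: ler_pM => //; apply: le_trans (ler_normB _ _) _; rewrite -[2]/(1 + 1).
by apply: lerD; apply: M1; exact: le1.
Qed.

(** Provides a rectangle of positive measure on which the kernel is a nonzero constant when [c] is
    nonzero. *)
Lemma regular_kernel_rect c x y : quarter 0 x -> quarter 2 y ->
  regular_kernel c x y = c.
Proof.
have ind1 j z : quarter j z -> indq j z = 1.
  by move=> jz; rewrite /indq indicE mem_set.
have ind0 i j z : quarter i z -> i != j -> indq j z = 0.
  by move=> iz ij; rewrite -[indq j z]mul1r -(ind1 _ _ iz) indq_mul (negbTE ij)
    mul0r.
move=> x0 y2; rewrite /regular_kernel /rank_two /qa /qb.
rewrite (ind1 _ _ x0) (ind1 _ _ y2) !(ind0 _ _ _ x0)// !(ind0 _ _ _ y2)//.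
by ring.
Qed.

Lemma hom_density_Qpath_regular c n : (0 < n)%N ->
  hom_density (Qpath n) (regular_kernel c) = 0.
Proof.
apply: hom_density_Qpath_rank_two; try exact: bounded_indqB.
- exact: qaE.
- exact: qbE.
Qed.

Lemma hom_density_Dcycle_regular c n :
  hom_density (Dcycle n.+2) (regular_kernel c) =
    2 * ((c * (1 / 2)) ^+ 2) ^+ n.+2.
Proof.
apply: hom_density_Dcycle_rank_two; try exact: bounded_indqB.
- under eq_Rintegral do rewrite qabE; exact: expect_cst.
- exact: qaaE.
- exact: qbbE.
Qed.

End quarters.

(** * The expansion around 1/2 *)

Section expansion.
Context (R : realType) (l : nat) (C : ograph).
Context (l_even : ~~ odd l) (C_cycle : cycle_orientation l C).
Implicit Types (U : R -> R -> R) (F : {set C * C}) (ns : seq nat).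

(** An even number that is at least 3 is at least 4; the form [n.+2.*2] is the one of the lemmas on
    [Dcycle n.+2]. *)
Lemma cycle_half : exists n, l = n.+2.*2.
Proof.
have [l3 _] := C_cycle; exists (l./2 - 2)%N.
by have := even_halfK l_even; lia.
Qed.

Lemma card_edges_cycle : #|edges C| = l.
Proof.
have [n ln] := cycle_half;
  rewrite -(adj_iso_card_edges (cycle_Dcycle C_cycle l_even)).
by rewrite ln doubleK card_edges_Dcycle.
Qed.

Lemma hom_density_Qunion ns m U : bounded_kernel U ->
  hom_density (dunion (Qunion ns) (edgeless m)) U =
  \prod_(n <- ns) hom_density (Qpath n) U.
Proof.
move=> bU; rewrite hom_density_dunion// hom_density_edgeless// mulr1.
elim: ns => [|n ns IH]; first by rewrite big_nil hom_density_edgeless.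
by rewrite big_cons -IH; exact: hom_density_dunion.
Qed.

Context (U : R -> R -> R) (bU : bounded_kernel U).
Context (antiU : forall x y, U x y = - U y x).

(** [C] is always a reorientation of [Dcycle l./2], with some parity; if the even one is impossible,
    the odd one holds and the sign is [gammaC]. *)
Lemma hom_density_gamma :
  hom_density C U = (gammaC l C)%:~R * hom_density (Dcycle l./2) U.
Proof.
rewrite /gammaC; case: asboolP => [ob|nob].
  by rewrite (hom_density_obtained bU antiU ob).
have [[] ob] := adj_iso_obtained (cycle_Dcycle C_cycle l_even); last by [].
by rewrite (hom_density_obtained bU antiU ob).
Qed.

Lemma edges_spanning (F : {set C * C}) : F \subset edges C ->
  edges (spanning F) = F.
Proof. exact: (fun h => elimT finset.setIidPr h). Qed.

(** Forgets the parity, so that the type depends on adjacency only and [Qunion_inj] gives its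
    uniqueness. *)
Definition of_type (F : {set C * C}) (ns : seq nat) : Prop :=
  exists b, obtained_by_reversing_and_isolated b (Qunion ns) (spanning F).

Lemma of_type_iso F ns : of_type F ns ->
  exists m, adj_iso (dunion (Qunion ns) (edgeless m)) (spanning F).
Proof. by move=> [b [m /obtained_adj_iso]]; exists m. Qed.

Lemma iso_of_type F ns m :
  adj_iso (dunion (Qunion ns) (edgeless m)) (spanning F) -> of_type F ns.
Proof. by move=> /adj_iso_obtained[b ob]; exists b, m. Qed.

Lemma of_type_card F ns : F \subset edges C -> of_type F ns ->
  #|F| = (\sum_(i <- ns) i.*2)%N.
Proof.
move=> FE /of_type_iso[m /adj_iso_card_edges].
by rewrite card_edges_Qunion (edges_spanning FE).
Qed.

Lemma obtained_density b F ns :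
  obtained_by_reversing_and_isolated b (Qunion ns) (spanning F) ->
  hom_density (spanning F) U =
    (-1) ^+ b * \prod_(n <- ns) hom_density (Qpath n) U.
Proof.
move=> [m ob].
by rewrite (hom_density_obtained bU antiU ob) hom_density_Qunion.
Qed.

(* If [F] arises with both parities, its density vanishes, so the two
   contributions of [F] to alpha cancel consistently. *)
Lemma signed_type_density F ns : F \subset edges C ->
  let ob b := `[< obtained_by_reversing_and_isolated b (Qunion ns) (spanning F)
    >] in
  ((ob false)%:R - (ob true)%:R) / 2 ^+ (l - \sum_(i <- ns) i.*2)
    * \prod_(n <- ns) hom_density (Qpath n) U =
  if `[< of_type F ns >] then hom_density (spanning F) U / 2 ^+ (l - #|F|) else
    0.
Proof.
move=> FE ob; case: asboolP => [ty|nty]; last first.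
  have ob0 b : ob b = false by apply/asboolP => obb; apply: nty; exists b.
  by rewrite !ob0 subrr !mul0r.
rewrite (of_type_card FE ty) mulrAC; congr (_ / _); rewrite /ob.
case: asboolP => [/obtained_density t0|n0];
  case: asboolP => [/obtained_density t1|n1].
- by move: t0 t1; rewrite expr0 expr1 => -> h; lra.
- by rewrite t0 expr0 subr0.
- by rewrite t1 expr1 sub0r.
- by case: ty => -[].
Qed.

Lemma alphaC_sum ns : (alphaC C ns)%:~R =
  \sum_(F : {set C * C} | F \subset edges C)
    (`[< obtained_by_reversing_and_isolated false (Qunion ns) (spanning F) >]%:R
      -
     `[< obtained_by_reversing_and_isolated true (Qunion ns) (spanning F) >]%:R)
       :> R.
Proof.
rewrite /alphaC rmorphB/= sumrB -!pmulrn; congr (_ - _).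
  rewrite -sum1_card natr_sum [RHS]big_mkcond [LHS]big_mkcond/=.
  by apply: eq_bigr => F _; rewrite inE; case: (F \subset _); case: asboolP.
rewrite -sum1_card natr_sum [RHS]big_mkcond [LHS]big_mkcond/=.
by apply: eq_bigr => F _; rewrite inE; case: (F \subset _); case: asboolP.
Qed.

Local Notation tuple_ok k n :=
  [&& all (fun i : 'I_l.+1 => 1 <= i)%N n,
      sorted (fun i j : 'I_l.+1 => i <= j)%N n &
      (k + \sum_(i <- n) i.*2 <= l)%N].

(** At most one index of the double sum is a type of [F]. There is none for the two extreme sets;
    for the others there is exactly one unless [F] has a path of odd length, and then the density,
    hence [r], is 0. *)
Lemma sum_types (F : {set C * C}) (r : R) : F \subset edges C ->
  (hom_density (spanning F) U = 0 -> r = 0) ->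
  \sum_(k < l.+1 | (1 <= k)%N) \sum_(n : k.-tuple 'I_l.+1 | tuple_ok k n)
    (if `[< of_type F [seq val i | i <- n] >] then r else 0) =
  if (F == finset.set0) || (F == edges C) then 0 else r.
Proof.
move=> FE r0.
have size_ns k (n : k.-tuple 'I_l.+1) : size [seq val i | i <- n] = k.
  by rewrite size_map size_tuple.
have sum_ns k (n : k.-tuple 'I_l.+1) :
    (\sum_(i <- [seq val i | i <- n]) i.*2 = \sum_(i <- n) i.*2)%N.
  by rewrite big_map.
have [FT|] := ifPn.
  (* The full edge set would need [k + l <= l] with [k >= 1]; the empty set would need an empty
     list. *)
  apply: big1 => k k1; apply: big1 => n /and3P[n1 _ kn].
  case: asboolP => // /(of_type_card FE); rewrite sum_ns => cF.
  case/orP: FT => /eqP FT; last by move: cF; rewrite FT card_edges_cycle; lia.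
  move: cF; rewrite FT cards0; case: n n1 {kn} => -[|i n] /= ni.
    by move: ni k1; case: (k : nat).
  by case/andP => i1 _; rewrite big_cons; lia.
rewrite negb_or => /andP[Fn0 FnE].
have [b Fb] := spanning_proper_lin C_cycle FE FnE.
have [[m [G [om iso]]]|[ns [m [ns1 ns_sorted iso]]]] := lin_components l b.
  rewrite r0; first by do 2 (apply: big1 => ? _); case: ifP.
  have [e ob] := adj_iso_obtained (adj_iso_trans iso Fb).
  rewrite (hom_density_obtained bU antiU ob) hom_density_dunion//.
  suff -> : hom_density (dipath m) U = 0 by rewrite mul0r mulr0.
  have := hom_density_obtained bU antiU (dipath_reverse m).
  by rewrite om expr1; lra.
have {}iso := adj_iso_trans iso Fb.
have cF := of_type_card FE (iso_of_type iso).
(* Counting vertices yields the index constraint: a path with [2n] edges has [2n + 1] vertices. *)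
have cC : (size ns + \sum_(i <- ns) i.*2 + m = l)%N.
  rewrite -card_Qunion (adj_iso_card iso).
  by have [_ [f /bij_eq_card]] := C_cycle; rewrite card_ord.
have uniq_ns k (n : k.-tuple 'I_l.+1) : tuple_ok k n ->
    of_type F [seq val i | i <- n] -> [seq val i | i <- n] = ns.
  move=> /and3P[n1 ns' _] /of_type_iso[m' iso'].
  apply: (@Qunion_inj _ _ m' m) => //.
  - by rewrite all_map.
  - by rewrite sorted_map.
  - exact: adj_iso_trans iso' (adj_iso_sym iso).
have ns_le i : i \in ns -> (i < l.+1)%N.
  move=> ins; have : (i.*2 <= \sum_(j <- ns) j.*2)%N.
    by rewrite (big_rem i)//= leq_addr.
  by lia.
have size_lt : (size ns < l.+1)%N by lia.
pose k0 := Ordinal size_lt.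
pose t0 : seq 'I_l.+1 := [seq inord i | i <- ns].
have t0K : [seq val i | i <- t0] = ns.
  rewrite -map_comp -[RHS]map_id; apply/eq_in_map => i /ns_le i_lt /=.
  by rewrite inordK.
have size_t0 : size t0 == k0 by rewrite size_map.
pose n0 : k0.-tuple 'I_l.+1 := Tuple size_t0.
have k01 : (1 <= k0)%N.
  rewrite lt0n size_eq0; apply: contra Fn0 => /eqP ns0.
  by rewrite -cards_eq0 cF ns0 big_nil.
have n0ok : tuple_ok k0 n0.
  apply/and3P; split.
  - by move: ns1; rewrite -{1}t0K all_map.
  - by move: ns_sorted; rewrite -{1}t0K sorted_map.
  - by have := sum_ns _ n0; rewrite /= t0K => <-; lia.
rewrite (bigD1 k0)//= (bigD1 n0)//= t0K ifT; last first.
  by apply/asboolP; exact: iso_of_type iso.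
rewrite big1 ?addr0; last first.
  move=> n /andP[nok nn0]; case: asboolP => // /(uniq_ns _ _ nok) nns.
  case/eqP: nn0; apply: val_inj; apply: (inj_map val_inj); rewrite nns.
  by rewrite /= t0K.
rewrite big1 ?addr0// => k /andP[_ kk0]; apply: big1 => n nok.
case: asboolP => // /(uniq_ns _ _ nok) nns; case/eqP: kk0; apply: val_inj.
by rewrite /= -nns size_ns.
Qed.

(** The empty edge set gives [2 ^- l], the full one the term in D_l, and every other one is matched
    with its type by [sum_types]. *)
Lemma hom_density_expansion :
  hom_density C (fun x y => 1 / 2 + U x y) = 2 ^- l + cycle_form l C U.
Proof.
have C0 : finset.set0 != edges C.
  rewrite eq_sym -cards_eq0 card_edges_cycle.
  by have [l3 _] := C_cycle; lia.
rewrite hom_density_half// card_edges_cycle.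
rewrite (bigD1 finset.set0) ?finset.sub0set//= cards0 subn0.
rewrite (_ : hom_density _ U = 1); last first.
  rewrite hom_densityE// /expect_coords (@edges_spanning finset.set0)
    ?finset.sub0set//.
  by under eq_Rintegral do rewrite big_set0; rewrite expect_cst.
rewrite mul1r; congr (_ + _).
rewrite (bigD1 (edges C)) ?subxx 1?eq_sym//= card_edges_cycle subnn divr1 addrC.
rewrite /cycle_form; congr (_ + _); last first.
  rewrite -hom_density_gamma; apply: hom_density_iso => //.
  by exists id => [|u v]; [exists id|rewrite edges_spanning].
have termE k (n : k.-tuple 'I_l.+1) :
    (alphaC C [seq val i | i <- n])%:~R / 2 ^+ (l - \sum_(i <- n) i.*2)%N
      * \prod_(i <- n) hom_density (Qpath i) U =
    \sum_(F : {set C * C} | F \subset edges C)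
      if `[< of_type F [seq val i | i <- n] >]
      then hom_density (spanning F) U / 2 ^+ (l - #|F|) else 0.
  have -> : (\sum_(i <- n) i.*2 = \sum_(i <- [seq val i | i <- n]) i.*2)%N.
    by rewrite big_map.
  have -> : \prod_(i <- n) hom_density (Qpath i) U =
      \prod_(i <- [seq val i | i <- n]) hom_density (Qpath i) U.
    by rewrite big_map.
  rewrite alphaC_sum mulr_suml mulr_suml; apply: eq_bigr => F FE.
  exact: signed_type_density.
(* With the sum over [F] outermost, the inner double sum is the one of [sum_types]. *)
transitivity (\sum_(F : {set C * C} | F \subset edges C)
    \sum_(k < l.+1 | (1 <= k)%N) \sum_(n : k.-tuple 'I_l.+1 | tuple_ok k n)
    (if `[< of_type F [seq val i | i <- n] >]
     then hom_density (spanning F) U / 2 ^+ (l - #|F|) else 0)); last first.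
  rewrite exchange_big/=; apply: eq_bigr => k _.
  by rewrite exchange_big/=; apply: eq_bigr => n _; rewrite termE.
rewrite [LHS]big_mkcond [RHS]big_mkcond/=.
apply: eq_bigr => F _; case: (boolP (F \subset edges C)) => //= FE.
rewrite sum_types//; last by move=> ->; rewrite mul0r.
by case: eqP; case: eqP.
Qed.

End expansion.

(** * Extension of kernels from the unit square to the plane *)

Section clamp.
Context (R : realType).
Local Notation mR := (measurableTypeR R).
Local Notation I := (`[0%R, 1%R]%classic : set R).

Definition clamp (x : R) : R := Num.max 0 (Num.min x 1).

Lemma clamp_itv x : I (clamp x).
Proof.
by rewrite /= in_itv /= /clamp le_max lexx ge_max ler01 ge_min lexx orbT.
Qed.

Lemma clamp_id x : I x -> clamp x = x.
Proof.
rewrite /= in_itv /= /clamp => /andP[x0 x1].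
by rewrite (min_idPl x1) (max_idPr x0).
Qed.

Lemma measurable_clamp : measurable_fun setT (clamp : mR -> mR).
Proof. by apply: measurable_maxr => //; exact: measurable_minr. Qed.

(* Kernels are only constrained on the unit square; clamping extends them to
   the plane without changing any density. *)
Lemma bounded_kernel_clamp (U : R -> R -> R) : is_kernel U ->
  bounded_kernel (fun x y => U (clamp x) (clamp y)).
Proof.
move=> [mU [M UM]]; split; last by exists M => p; apply: UM; exact: clamp_itv.
pose h (p : mR * mR) : mR * mR := (clamp p.1, clamp p.2).
apply: (@measurable_comp _ _ _ (mR * mR)%type (mR * mR)%type mR (I `*` I)
  (fun p => U p.1 p.2) setT h).
- by apply: measurableX; exact: measurable_itv.
- by move=> _ [p _ <-]; split; exact: clamp_itv.
- exact: mU.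
- by apply: measurable_fun_pair; apply: measurableT_comp => //;
    exact: measurable_clamp.
Qed.

End clamp.

(** * The crossing argument *)

Section forcing.
Context (R : realType) (l : nat) (C : ograph).
Context (l_even : ~~ odd l) (C_cycle : cycle_orientation l C).
Local Notation mR := (measurableTypeR R).
Local Notation I := (`[0%R, 1%R]%classic : set R).
Implicit Types U V : R -> R -> R.

Definition half_kernel U : Prop :=
  [/\ bounded_kernel U, forall x y, U x y = - U y x &
      forall x y, `|U x y| <= 1 / 2].

Lemma half_kernel_mix U V s : half_kernel U -> half_kernel V -> 0 <= s <= 1 ->
  half_kernel (fun x y => (1 - s) * U x y + s * V x y).
Proof.
move=> [bU antiU U2] [bV antiV V2] /andP[s0 s1]; split.
- by apply: bounded_measurableD; exact: bounded_measurableZ.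
- by move=> x y; rewrite antiU (antiV x); ring.
- move=> x y; apply: le_trans (ler_normD _ _) _.
  have s1' : 0 <= 1 - s by rewrite subr_ge0.
  rewrite !normrM (ger0_norm s0) (ger0_norm s1').
  rewrite [leRHS](_ : _ = (1 - s) * (1 / 2) + s * (1 / 2)); last by ring.
  by apply: lerD; apply: ler_wpM2l.
Qed.

Lemma tournamenton_half U : half_kernel U ->
  tournamenton (fun x y => 1 / 2 + U x y).
Proof.
move=> [bU antiU U2].
have : bounded_kernel (fun x y => 1 / 2 + U x y).
  exact: (bounded_measurableD (bounded_measurable_cst _ (1 / 2)) bU).
case=> mW [M WM]; split.
- split; last by exists M => x y _ _; exact: (WM (x, y)).
  exact: measurable_funTS.
- by move=> x y _ _; have := U2 x y; rewrite ler_norml => /andP[]; lra.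
- by move=> x y _ _; rewrite (antiU y x); field.
Qed.

(** The density deviates from [2 ^- l] in opposite directions at the two ends of the segment, so it
    takes that value in between, where forcing applies. *)
Lemma forcing_crossing U V : half_kernel U -> half_kernel V ->
  quasirandom_forcing R C -> cycle_form l C U * cycle_form l C V < 0 ->
  exists2 s, 0 < s < 1 &
    ae_eq (@lebesgue_measure R \x @lebesgue_measure R)%E (I `*` I)
      (fun p => (1 - s) * U p.1 p.2 + s * V p.1 p.2) (fun=> 0).
Proof.
move=> hU hV forcing UV0; have [bU antiU _] := hU; have [bV antiV _] := hV.
have bc : bounded_kernel (fun _ _ => 1 / 2 : R)
  by exact: bounded_measurable_cst.
have [p pE] := hom_densityZD_poly C bU bV bc.
have p0 : p.[0] = 2 ^- l + cycle_form l C U.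
  rewrite -pE -hom_density_expansion//; congr hom_density.
  by apply/funext => x; apply/funext => y; ring.
have p1 : p.[1] = 2 ^- l + cycle_form l C V.
  rewrite -pE -hom_density_expansion//; congr hom_density.
  by apply/funext => x; apply/funext => y; ring.
(* The factor [cycle_form l C V] normalises the signs: [q] goes from negative to positive whichever
   end has the negative form. *)
pose q := cycle_form l C V *: (p - (2 ^- l)%:P).
have qE s : q.[s] = cycle_form l C V * (p.[s] - 2 ^- l).
  by rewrite /q hornerZ hornerD hornerN hornerC.
have q0 : q.[0] < 0 by rewrite qE p0 addrC addKr mulrC.
have V0 : cycle_form l C V != 0.
  by apply: contraTneq UV0 => ->; rewrite mulr0 ltxx.
have q1 : 0 < q.[1].
  by rewrite qE p1 addrC addKr -expr2 lt0r sqrf_eq0 V0 sqr_ge0.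
have [s /andP[s0 s1] /eqP qs] : exists2 s, 0 <= s <= 1 & root q s.
  by apply: poly_ivt => //; rewrite (ltW q0) (ltW q1).
have s01 : 0 < s < 1.
  rewrite !lt_neqAle s0 s1 !andbT; apply/andP; split.
    by apply: contraTneq q0 => e; rewrite -leNgt; move: qs; rewrite -e => ->.
  by apply: contraTneq q1 => e; rewrite -leNgt; move: qs; rewrite e => ->.
exists s => //.
have hs : half_kernel (fun x y => (1 - s) * U x y + s * V x y).
  by apply: half_kernel_mix => //; rewrite s0 s1.
have ps : p.[s] = 2 ^- l.
  move/eqP: qs; rewrite qE mulf_eq0 (negbTE V0) /= subr_eq0 => /eqP //.
have := forcing _ (tournamenton_half hs).
rewrite (card_edges_cycle l_even C_cycle) pE ps => /(_ erefl).
apply: filterS => xy h /h /=; lra.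
Qed.

Lemma half_kernel_regular c : `|c| <=
  1 / 4 -> half_kernel (regular_kernel c : R -> R -> R).
Proof.
move=> c4; split; first exact: bounded_regular_kernel.
- exact: rank_two_anti.
- by move=> x y; exact: regular_kernel_le.
Qed.

(** Every product over a nonempty list contains a vanishing [Qpath] factor. Only the D_l term
    survives, and its sign [gammaC] gets squared. *)
Lemma cycle_form_regular c : c != 0 ->
  0 < (gammaC l C)%:~R * cycle_form l C (regular_kernel c : R -> R -> R).
Proof.
move=> c0; have [n ln] := cycle_half l_even C_cycle.
rewrite /cycle_form big1 ?add0r; last first.
  move=> k k1; apply: big1 => t /and3P[t1 _ _].
  case: t t1 => -[|i t] /= ti; first by move: ti k1; case: (k : nat).
  move=> /andP[i1 _].
  by rewrite [\prod_(_ <- _) _]big_cons hom_density_Qpath_regular// mul0r mulr0.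
rewrite mulrA -intrM; have -> : gammaC l C * gammaC l C = 1.
  by rewrite /gammaC; case: asboolP.
rewrite mul1r ln doubleK hom_density_Dcycle_regular mulr_gt0// exprn_gt0//.
by rewrite exprn_even_gt0//= mulf_neq0.
Qed.

Lemma regular_kernel_not_ae0 c : c != 0 ->
  ~ ae_eq (@lebesgue_measure R \x @lebesgue_measure R)%E (I `*` I)
      (fun p => regular_kernel c p.1 p.2) (fun=> 0).
Proof.
move=> c0 [N [mN N0 subN]].
have mq j : measurable (@quarter R j) by exact: measurable_quarter.
have muq j : (@lebesgue_measure R (quarter j) = (1 / 4)%:E)%E.
  rewrite lebesgue_measure_itv /= lte_fin ltr_pM2r ?invr_gt0// ltr_nat ltnSn.
  by rewrite -EFinB -mulrBl -natrB// subSnn.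
(* A rectangle of measure 1/16 would have to lie in the null set [N]. *)
have sub : @quarter R 0 `*` @quarter R 2 `<=` N.
  move=> [x y] [/= x0 y2]; apply: subN => /= h.
  have xI : I x.
    move: x0; rewrite /quarter /= !in_itv /=; lra.
  have yI : I y.
    move: y2; rewrite /quarter /= !in_itv /=; lra.
  by move: (h (conj xI yI)); rewrite regular_kernel_rect// => /eqP;
    rewrite (negbTE c0).
have : ((@lebesgue_measure R \x @lebesgue_measure R)
    (@quarter R 0 `*` @quarter R 2) <= 0)%E.
  by rewrite -N0; apply: le_measure => //; rewrite inE//; exact: measurableX.
rewrite product_measure1E// [X in (X * _)%E]muq [X in (_ * X)%E]muq -EFinM
  lee_fin.
lra.
Qed.

(** The factor [gammaC] treats both signs at once: the form has the sign of [gammaC] at both regular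
    kernels and the opposite sign at [U]. *)
Lemma not_forcing U : half_kernel U ->
  (gammaC l C)%:~R * cycle_form l C U < 0 -> ~ quasirandom_forcing R C.
Proof.
move=> hU gU forcing.
have sg : (gammaC l C)%:~R * (gammaC l C)%:~R = 1 :> R.
  by rewrite /gammaC; case: asboolP => _; rewrite ?mulr1 ?mulrNN ?mulr1.
have crossing c : c != 0 -> `|c| <= 1 / 4 -> exists2 s, 0 < s < 1 &
    ae_eq (@lebesgue_measure R \x @lebesgue_measure R)%E (I `*` I)
      (fun p => (1 - s) * U p.1 p.2 + s * regular_kernel c p.1 p.2) (fun=> 0).
  move=> c0 c4; apply: forcing_crossing => //; first exact: half_kernel_regular.
  rewrite -[_ * _]mul1r -sg mulrACA nmulr_rlt0//.
  exact: cycle_form_regular.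
have c4 : `|1 / 4| <= 1 / 4 :> R by rewrite ger0_norm.
have c0 : 1 / 4 != 0 :> R by rewrite mulf_neq0// invr_neq0.
have [s /andP[s0 s1] sE] := crossing _ c0 c4.
have [||s' /andP[s'0 s'1] s'E] := crossing (- (1 / 4)).
- by rewrite oppr_eq0.
- by rewrite normrN.
apply: (regular_kernel_not_ae0 c0).
apply: filterS2 sE s'E => -[x y] e e' xyI; move: (e xyI) (e' xyI) => /=.
rewrite regular_kernelN; set u := U x y;
  set v := regular_kernel _ x y => uv uv'.
(* This combination of the two equations eliminates [u]; the coefficient of [v] is positive because
   [s] and [s'] lie strictly between 0 and 1. *)
have : ((1 - s') * s + (1 - s) * s') * v = 0.
  transitivity ((1 - s') * ((1 - s) * u + s * v) - (1 - s) *
    ((1 - s') * u + s' * - v)).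
    by ring.
  by rewrite uv uv' !mulr0 subr0.
move/eqP; rewrite mulf_eq0 => /orP[|/eqP//]; rewrite gt_eqF//.
by rewrite addr_gt0// mulr_gt0// subr_gt0.
Qed.

End forcing.

Theorem theorem19 (R : realType) (l : nat) (C : ograph)
    (l_even : ~~ odd l) (C_cycle : cycle_orientation l C) :
  (gammaC l C = 1 ->
   (exists U : R -> R -> R,
      [/\ antisymmetric_kernel U,
          (forall x y : R, 0 <= x <= 1 -> 0 <= y <= 1 ->
             - (1 / 2) <= U x y <= 1 / 2) &
          cycle_form l C U < 0]) ->
   ~ quasirandom_forcing R C) /\
  (gammaC l C = -1 ->
   (exists U : R -> R -> R,
      [/\ antisymmetric_kernel U,
          (forall x y : R, 0 <= x <= 1 -> 0 <= y <= 1 ->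
             - (1 / 2) <= U x y <= 1 / 2) &
          cycle_form l C U > 0]) ->
   ~ quasirandom_forcing R C).
Proof.
(* The hypotheses on [U] hold on the unit square only; clamping extends them to the plane and leaves
   the form unchanged. *)
have clampP (U : R -> R -> R) : antisymmetric_kernel U ->
    (forall x y : R, 0 <= x <= 1 -> 0 <= y <= 1 ->
      - (1 / 2) <= U x y <= 1 / 2) ->
    half_kernel (fun x y => U (clamp x) (clamp y)) /\
    cycle_form l C (fun x y => U (clamp x) (clamp y)) = cycle_form l C U.
  move=> [kU antiU] U2; split.
    split; first exact: bounded_kernel_clamp.
      by move=> x y; apply: antiU; exact: clamp_itv.
    move=> x y; rewrite ler_norml; apply: U2.
      by have := clamp_itv x; rewrite /= in_itv.
    by have := clamp_itv y; rewrite /= in_itv.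
  have hE H : hom_density H (fun x y => U (clamp x) (clamp y)) =
    hom_density H U.
    by apply: eq_hom_density => x y xI yI; rewrite !clamp_id.
  rewrite /cycle_form hE; congr (_ + _); apply: eq_bigr => k _.
  apply: eq_bigr => n _; congr (_ * _); apply: eq_bigr => i _; exact: hE.
split=> g [U [aU U2 cU]]; have [hU cE] := clampP U aU U2;
  apply: (not_forcing l_even C_cycle hU); rewrite cE g.
- by rewrite mul1r.
- by rewrite mulN1r oppr_lt0.
Qed.
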